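(* Let $k\ge 2$, let $I_1,\dots,I_k$ be pairwise disjoint compact intervals in $[0,1)$ and let $L\subset[0,1)$ be a compact interval containing $I_1\cup\dots\cup I_k$. Then for each $M>0$ and $\alpha>0$ there exists $\varepsilon>0$ such that for every $S\in\mathcal A(M,\varepsilon,\alpha)$ the Cantor set $C_S$ is not $C^1$-minimal, i.e. there is no $C^1$ diffeomorphism $f:S^1\to S^1$ having $C_S$ as a minimal set.
   Context: Identify $S^1=\mathbb R/\mathbb Z$ with $[0,1)$; one normalizes so that $L=[0,1/2]$ and $(1/2,1)$ is a complementary interval of $C_S$ in $S^1$. Let $I=I_1\cup\dots\cup I_k$. For $r\ge 1$, $\mathcal S^r(I_1,\dots,I_k,L)$ is the set of $C^r$ maps $S:I\to L$ with $S(I_j)=L$ for each $j$ and $|S'|>1$ on $I$ ($C^{1+\alpha}$ means $C^1$ with $\alpha$-Hölder derivative). For such $S$, $C_S=\{x\in I: S^n(x)\in I \text{ for all } n\ge 1\}$, a Cantor set. The nonlinearity of $S$ is $\mathcal N(S)=\max_{j}\sup_{x,y\in I_j}\log\frac{|S'(x)|}{|S'(y)|}$. For $M,\varepsilon,\alpha>0$, $\mathcal A(M,\varepsilon,\alpha)$ is the set of $S\in\mathcal S^{1+\alpha}(I_1,\dots,I_k,L)$ with $\mathcal N(S)<\varepsilon$ and $\left|\log\frac{|S'(x)|}{|S'(y)|}\right|\le M|x-y|^\alpha$ for all $x,y$ in a common $I_j$. A closed set $K\subset S^1$ is a minimal set of a homeomorphism $f$ if it is nonempty, $f$-invariant, and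 every $f$-orbit in $K$ is dense in $K$. *)

(* Defs.v *)
From Stdlib Require Import Reals.
Open Scope R_scope.

Definition inI (k : nat) (a b : nat -> R) (x : R) : Prop :=
  exists j, (j < k)%nat /\ a j <= x <= b j.

Definition has_deriv_within (S dS : R -> R) (c d : R) : Prop :=
  forall x, c <= x <= d ->
    forall eps, 0 < eps -> exists delta, 0 < delta /\
      forall y, c <= y <= d -> y <> x -> Rabs (y - x) < delta ->
        Rabs ((S y - S x) / (y - x) - dS x) < eps.

Definition in_S1alpha (k : nat) (a b : nat -> R) (l1 l2 alpha : R)
    (S dS : R -> R) : Prop :=
  (forall j, (j < k)%nat -> has_deriv_within S dS (a j) (b j)) /\
  (exists H, forall j x y, (j < k)%nat -> a j <= x <= b j -> a j <= y <= b j ->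
      Rabs (dS x - dS y) <= H * Rpower (Rabs (x - y)) alpha) /\
  (forall j, (j < k)%nat ->
      (forall x, a j <= x <= b j -> l1 <= S x <= l2) /\
      (forall y, l1 <= y <= l2 -> exists x, a j <= x <= b j /\ S x = y)) /\
  (forall x, inI k a b x -> 1 < Rabs (dS x)).

(** Nonlinearity N(S) < eps: the max over j of the sup of log(|S'x|/|S'y|)
    over x,y in I_j is < eps. *)
Definition nonlin_lt (k : nat) (a b : nat -> R) (dS : R -> R) (eps : R) : Prop :=
  exists eta, eta < eps /\
    forall j x y, (j < k)%nat -> a j <= x <= b j -> a j <= y <= b j ->
      ln (Rabs (dS x) / Rabs (dS y)) <= eta.

Definition in_A (k : nat) (a b : nat -> R) (l1 l2 M eps alpha : R)
    (S dS : R -> R) : Prop :=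
  in_S1alpha k a b l1 l2 alpha S dS /\
  nonlin_lt k a b dS eps /\
  (forall j x y, (j < k)%nat -> a j <= x <= b j -> a j <= y <= b j ->
      Rabs (ln (Rabs (dS x) / Rabs (dS y))) <= M * Rpower (Rabs (x - y)) alpha).

Definition CS (k : nat) (a b : nat -> R) (S : R -> R) (x : R) : Prop :=
  inI k a b x /\ forall n, (1 <= n)%nat -> inI k a b (Nat.iter n S x).

(** Circle S^1 = R/Z identified with [0,1); points of S^1 are reals in [0,1). *)
Definition circ_close (x y eps : R) : Prop :=
  exists m : Z, Rabs (x - y - IZR m) < eps.

Definition circle_C1_diffeo_lift (F dF : R -> R) : Prop :=
  (forall x, derivable_pt_lim F x (dF x)) /\
  continuity dF /\
  (forall x, dF x <> 0) /\
  (exists d, (d = 1 \/ d = -1) /\ forall x, F (x + 1) = F x + d).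

(** The induced circle map on [0,1): x |-> frac(F x). Orbit of x (full, i.e.
    forward and backward iterates): z = f^n(x) or x = f^n(z) for some n. *)
Definition in_orbit (F : R -> R) (x z : R) : Prop :=
  0 <= z < 1 /\
  exists n : nat, z = frac_part (Nat.iter n F x) \/ x = frac_part (Nat.iter n F z).

Definition minimal_set (F : R -> R) (K : R -> Prop) : Prop :=
  (forall x, K x -> 0 <= x < 1) /\
  (exists x, K x) /\
  (forall x, 0 <= x < 1 ->
     (forall eps, 0 < eps -> exists y, K y /\ circ_close x y eps) -> K x) /\
  (forall x, K x -> K (frac_part (F x))) /\
  (forall y, K y -> exists x, K x /\ y = frac_part (F x)) /\
  (forall x y, K x -> K y -> forall eps, 0 < eps ->
     exists z, in_orbit F x z /\ circ_close z y eps).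

Definition C1_minimal (K : R -> Prop) : Prop :=
  exists F dF, circle_C1_diffeo_lift F dF /\ minimal_set F K.

(* Main.v *)
Require Import Defs.
From Stdlib Require Import Reals Lra Lia List Classical Psatz ZArith.
Open Scope R_scope.

(** Let [f] be a C^1 circle diffeomorphism with minimal set [C = C_S]. Consider
    two nearby gaps of [C] and, as their shape, the lengths of the second gap and
    of the interval between the two, relative to the first gap. Iterating [S]
    blows such a pair up to unit scale and changes its shape by a factor close
    to 1 when the nonlinearity is small; at unit scale only boundedly many gaps
    exist, so the shapes lie in a bounded number of tiny clusters, and this
    number does not depend on [S]. On tiny intervals [f] changes shapes by tiny
    factors only, hence cannot move a shape far across the clusters. Gaps wander
    under [f], so their lengths tend to 0; starting from a tiny gap and a
    neighbouring gap of comparable size, all iterates of the pair keep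
    comparable shapes, and the interval [T] spanned by it satisfies
    [|f^n T| -> 0]. As [T] contains points of [C] in its interior, minimality
    gives [f^n T] inside [T] for some [n >= 1], hence a periodic point in [C],
    which contradicts minimality because [C] is infinite. *)

(** * Distortion of the generating map *)

(** The number of blow-up steps is unbounded, so a bound per step from the nonlinearity is not
    enough, while the Hölder bound is summable but not small. Interpolating between them makes the
    total distortion small; this costs half of the exponent, hence [alpha / 2].

    For [f] only continuity of the derivative is available, so its distortion cannot be summed along
    an orbit. The clusters replace summation: at every time the shape is compared afresh with a
    finite set, and one step of [f] is shorter than some free stretch between clusters.

    There is a circularity to break. Clusters exist only for shapes that are already bounded, since
    the bound is what makes both gaps long at unit scale. So a window is fixed beforehand, larger by
    a factor 2 than the bounds on the initial shape. It determines the number of clusters, this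
    number the resolution needed, the resolution the admissible distortion, and only then is [eps]
    chosen. None of these constants involves [f]; the length of the initial gap does, and it is
    chosen last. *)

Lemma mvt_within (S dS : R -> R) (c d : R) :
  has_deriv_within S dS c d ->
  forall x y, c <= x -> x < y -> y <= d ->
    exists z, x <= z <= y /\ S y - S x = dS z * (y - x).
Proof.
  intros HD x y Hcx Hxy Hyd.
  (* [E] continues [S] along its end tangents, which turns the one-sided derivatives at [c] and [d]
     into two-sided ones. *)
  set (E := fun t => if Rlt_dec t c then S c + dS c * (t - c)
                     else if Rlt_dec d t then S d + dS d * (t - d) else S t).
  assert (EI : forall t, c <= t <= d -> E t = S t).
  { intros t Ht. unfold E. destruct (Rlt_dec t c); [lra|].
    destruct (Rlt_dec d t); [lra|reflexivity]. }
  assert (HE : forall t, c <= t <= d -> derivable_pt_lim E t (dS t)).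
  { intros t Ht eps Heps.
    destruct (HD t Ht eps Heps) as [del [Hdel Hd]].
    assert (H1 : exists e1, 0 < e1 /\ (t = c \/ e1 <= t - c)).
    { destruct (Req_dec t c); [exists 1; lra|exists (t - c); lra]. }
    assert (H2 : exists e2, 0 < e2 /\ (t = d \/ e2 <= d - t)).
    { destruct (Req_dec t d); [exists 1; lra|exists (d - t); lra]. }
    destruct H1 as [e1 [He1 H1]]. destruct H2 as [e2 [He2 H2]].
    assert (Hm : 0 < Rmin del (Rmin e1 e2)) by (repeat apply Rmin_pos; assumption).
    exists (mkposreal _ Hm). intros h Hh0 Hh. simpl in Hh.
    assert (Rabs h < del /\ Rabs h < e1 /\ Rabs h < e2) as [A1 [A2 A3]].
    { pose proof (Rmin_l del (Rmin e1 e2)). pose proof (Rmin_r del (Rmin e1 e2)).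
      pose proof (Rmin_l e1 e2). pose proof (Rmin_r e1 e2). lra. }
    apply Rabs_def2 in A2. apply Rabs_def2 in A3.
    rewrite (EI t Ht).
    unfold E. destruct (Rlt_dec (t + h) c).
    - destruct H1 as [->|H1]; [|lra].
      replace ((S c + dS c * (c + h - c) - S c) / h - dS c) with 0 by (field; lra).
      rewrite Rabs_R0; lra.
    - destruct (Rlt_dec d (t + h)).
      + destruct H2 as [->|H2]; [|lra].
        replace ((S d + dS d * (d + h - d) - S d) / h - dS d) with 0 by (field; lra).
        rewrite Rabs_R0; lra.
      + specialize (Hd (t + h)). replace (t + h - t) with h in Hd by ring.
        apply Hd; lra. }
  destruct (MVT_cor2 E dS x y Hxy) as [z [Hz1 Hz2]].
  { intros t Ht. apply HE. lra. }
  exists z. split; [lra|]. rewrite !EI in Hz1 by lra. exact Hz1.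
Qed.

Lemma Rpower_le_base (x y p : R) : 0 < x -> x <= y -> 0 < p -> Rpower x p <= Rpower y p.
Proof. intros. apply Rle_Rpower_l; lra. Qed.

Lemma holder_same_sign (f : R -> R) (c d H p : R) :
  0 < p -> c <= d ->
  (forall x y, c <= x <= d -> c <= y <= d -> Rabs (f x - f y) <= H * Rpower (Rabs (x - y)) p) ->
  (forall x, c <= x <= d -> 1 < Rabs (f x)) ->
  (forall x, c <= x <= d -> 0 < f x) \/ (forall x, c <= x <= d -> f x < 0).
Proof.
  intros Hp Hcd HH Hf.
  (* Composing with the 1-Lipschitz retraction onto [[c, d]] makes [f] continuous on the whole line,
     as the intermediate value theorem requires. *)
  set (cl := fun x => Rmax c (Rmin d x)).
  assert (Hcl : forall x, c <= cl x <= d).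
  { intros x. unfold cl. split; [apply Rmax_l|]. apply Rmax_lub; [lra|apply Rmin_l]. }
  assert (Hci : forall x, c <= x <= d -> cl x = x).
  { intros x Hx. unfold cl. rewrite Rmin_right, Rmax_right; lra. }
  assert (Hcc : forall x y, Rabs (cl x - cl y) <= Rabs (x - y)).
  { intros x y. unfold cl, Rmax, Rmin.
    repeat destruct (Rle_dec _ _); unfold Rabs; repeat destruct (Rcase_abs _); lra. }
  set (g := fun x => f (cl x)).
  (* [Rpower] is an exponential, hence positive even at base 0, so the bound at coinciding points
     gives the sign of [H]. For the same reason coinciding points need a separate case in the
     continuity proof. *)
  assert (H0 : 0 <= H).
  { specialize (HH c c ltac:(lra) ltac:(lra)).
    rewrite !Rminus_diag, Rabs_R0 in HH.
    unfold Rpower in HH. pose proof (exp_pos (p * ln 0)).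
    apply Rnot_lt_le. intro. nra. }
  assert (Hg : continuity g).
  { intros x eps Heps.
    set (q := eps / (H + 1)).
    assert (Hq : 0 < q) by (unfold q; apply Rdiv_lt_0_compat; lra).
    exists (Rpower q (/ p)). split; [apply exp_pos|].
    intros y [_ Hy]. simpl in *. unfold Rdist in *.
    destruct (Req_dec (cl y) (cl x)) as [e|ne].
    - unfold g. rewrite e, Rminus_diag, Rabs_R0. exact Heps.
    - unfold g. eapply Rle_lt_trans; [apply HH; apply Hcl|].
      assert (Hpos : 0 < Rabs (cl y - cl x)) by (apply Rabs_pos_lt; lra).
      assert (Rpower (Rabs (cl y - cl x)) p <= q).
      { replace q with (Rpower (Rpower q (/ p)) p).
        2:{ rewrite Rpower_mult, Rinv_l, Rpower_1; lra. }
        apply Rpower_le_base; try lra.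
        pose proof (Hcc y x). lra. }
      assert (H * q < eps).
      { unfold q. apply Rmult_lt_reg_r with (H + 1); [lra|].
        replace (H * (eps / (H + 1)) * (H + 1)) with (H * eps) by (field; lra). nra. }
      nra. }
  assert (Hz : forall x y, c <= x <= d -> c <= y <= d -> x <= y -> ~ f x * f y <= 0).
  { intros x y Hx Hy Hxy Hm.
    destruct (IVT_cor g x y Hg Hxy) as [z [Hz1 Hz2]].
    { unfold g. rewrite !Hci by lra. exact Hm. }
    unfold g in Hz2. specialize (Hf (cl z) (Hcl z)). rewrite Hz2, Rabs_R0 in Hf. lra. }
  assert (Hnz : forall x, c <= x <= d -> f x <> 0).
  { intros x Hx e. specialize (Hf x Hx). rewrite e, Rabs_R0 in Hf. lra. }
  destruct (Rlt_dec 0 (f c)) as [Hc|Hc].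
  - left. intros x Hx. specialize (Hz c x ltac:(lra) Hx ltac:(lra)).
    specialize (Hnz x Hx). nra.
  - right. intros x Hx. specialize (Hz c x ltac:(lra) Hx ltac:(lra)).
    pose proof (Hnz c ltac:(lra)). specialize (Hnz x Hx). nra.
Qed.

Definition strictly_monotone_on (S : R -> R) (c d : R) : Prop :=
  (forall x y, c <= x -> x < y -> y <= d -> S x < S y) \/
  (forall x y, c <= x -> x < y -> y <= d -> S y < S x).

Lemma exp_le (x y : R) : x <= y -> exp x <= exp y.
Proof. intros [H| ->]; [left; apply exp_increasing; exact H|right; reflexivity]. Qed.

(* [br_dist] holds with the geometric mean of the bounds coming from the
   nonlinearity and from the Hölder condition: it is then both small and
   summable along a chain of blow-ups. *)
Record branches (k : nat) (a b : nat -> R) (S : R -> R) (C : R -> Prop)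
    (g mu La si be : R) : Prop := {
  br_unit : exists h, h < 1 /\ forall x, C x -> 0 <= x <= h;
  br_in : forall x, C x -> exists j, (j < k)%nat /\ a j <= x <= b j;
  br_iff : forall j x, (j < k)%nat -> a j <= x <= b j -> (C x <-> C (S x));
  br_onto : forall j y, (j < k)%nat -> C y -> exists x, a j <= x <= b j /\ S x = y;
  br_mono : forall j, (j < k)%nat -> strictly_monotone_on S (a j) (b j);
  br_expand : forall j x y, (j < k)%nat -> a j <= x <= b j -> a j <= y <= b j ->
    mu * Rabs (x - y) <= Rabs (S x - S y) <= La * Rabs (x - y);
  br_dist : forall j s t x y u v, (j < k)%nat -> a j <= s -> s < t -> t <= b j ->
    s <= x <= t -> s <= y <= t -> s <= u <= t -> s <= v <= t ->
    Rabs (S y - S x) * Rabs (v - u) <=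
      exp (si * Rpower (t - s) be) * (Rabs (S v - S u) * Rabs (y - x));
  br_sep : forall i j x y, (i < k)%nat -> (j < k)%nat -> i <> j ->
    a i <= x <= b i -> a j <= y <= b j -> g <= Rabs (x - y) }.

Lemma CS_iff (k : nat) (a b : nat -> R) (S : R -> R) (x : R) :
  inI k a b x -> (CS k a b S x <-> CS k a b S (S x)).
Proof.
  intros Hx. split.
  - intros [_ H]. split.
    + exact (H 1%nat (le_n _)).
    + intros n Hn. specialize (H (Datatypes.S n) ltac:(lia)).
      rewrite Nat.iter_succ_r in H. exact H.
  - intros [H0 H]. split; [exact Hx|].
    intros n Hn. destruct n as [|n]; [lia|]. rewrite Nat.iter_succ_r.
    destruct n as [|n]; [exact H0|]. apply H. lia.
Qed.

(** [1 < Rabs (dS x)] gives no expansion uniform in [S]; full branches do. Another interval lies in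
    [L] at distance at least [g] from [I_j], so [L] is at least [1 + g] times as long as [I_j]; this
    is a lower bound for the mean slope, and the nonlinearity costs at most [exp eps]. Above, the
    mean slope is at most [1 / la] and [exp eps <= 3]. *)
Lemma branches_of_A (k : nat) (a b : nat -> R) (l1 l2 M eps alpha g la si : R)
    (S dS : R -> R) :
  (2 <= k)%nat ->
  (forall j, (j < k)%nat -> 0 <= a j < b j /\ b j < 1) ->
  0 <= l1 <= l2 -> l2 < 1 ->
  (forall j, (j < k)%nat -> l1 <= a j /\ b j <= l2) ->
  0 < M -> 0 < alpha -> 0 < g < 1 -> 0 < la -> 0 < si ->
  (forall i j x y, (i < k)%nat -> (j < k)%nat -> i <> j ->
    a i <= x <= b i -> a j <= y <= b j -> g <= Rabs (x - y)) ->
  (forall j, (j < k)%nat -> la <= b j - a j) ->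
  eps * M <= si * si -> exp eps * (1 + g / 2) <= 1 + g -> eps <= 1 ->
  in_A k a b l1 l2 M eps alpha S dS ->
  branches k a b S (CS k a b S) g (1 + g / 2) (3 / la) si (alpha / 2).
Proof.
  intros Hk Hab Hl Hl2 HL HM Hal Hg Hla Hsi Hsep Hlen HeM Heg He1
    [[HD [[H HH] [Honto Hgt]]] [[eta [Heta Hnl]] Hlog]].
  assert (Hnz : forall j x, (j < k)%nat -> a j <= x <= b j -> 0 < Rabs (dS x)).
  { intros j x Hj Hx. assert (1 < Rabs (dS x)) by (apply Hgt; exists j; auto). lra. }
  assert (Hmvt : forall j s t x y, (j < k)%nat -> a j <= s -> t <= b j ->
    s <= x <= t -> s <= y <= t -> x <> y ->
    exists z, s <= z <= t /\ Rabs (S y - S x) = Rabs (dS z) * Rabs (y - x)).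
  { intros j s t x y Hj Hs Ht Hx Hy Hne.
    destruct (Rlt_dec x y).
    - destruct (mvt_within _ _ _ _ (HD j Hj) x y) as [z [Hz1 Hz2]]; try lra.
      exists z. split; [lra|]. rewrite Hz2. apply Rabs_mult.
    - destruct (mvt_within _ _ _ _ (HD j Hj) y x) as [z [Hz1 Hz2]]; try lra.
      exists z. split; [lra|]. rewrite (Rabs_minus_sym (S y)), Hz2, Rabs_mult.
      rewrite (Rabs_minus_sym x y). reflexivity. }
  assert (Hder : forall j x y q, (j < k)%nat -> a j <= x <= b j -> a j <= y <= b j ->
    ln (Rabs (dS x) / Rabs (dS y)) <= q -> Rabs (dS x) <= exp q * Rabs (dS y)).
  { intros j x y q Hj Hx Hy Hq.
    pose proof (Hnz j x Hj Hx). pose proof (Hnz j y Hj Hy).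
    assert (0 < Rabs (dS x) / Rabs (dS y)) by (apply Rdiv_lt_0_compat; lra).
    apply exp_le in Hq. rewrite exp_ln in Hq by assumption.
    apply Rmult_le_compat_r with (r := Rabs (dS y)) in Hq; [|lra].
    replace (Rabs (dS x) / Rabs (dS y) * Rabs (dS y)) with (Rabs (dS x)) in Hq
      by (field; lra). exact Hq. }
  assert (Hd1 : forall j x y u v, (j < k)%nat -> a j <= x <= b j -> a j <= y <= b j ->
     a j <= u <= b j -> a j <= v <= b j ->
     Rabs (S y - S x) * Rabs (v - u) <= exp eps * (Rabs (S v - S u) * Rabs (y - x))).
  { intros j x y u v Hj Hx Hy Hu Hv.
    pose proof (exp_pos eps).
    destruct (Req_dec x y) as [->|Hxy].
    { rewrite !Rminus_diag, Rabs_R0. lra. }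
    destruct (Req_dec u v) as [->|Huv].
    { rewrite !Rminus_diag, Rabs_R0. lra. }
    destruct (Hmvt j (a j) (b j) x y) as [z [Hz ->]]; try lra; auto.
    destruct (Hmvt j (a j) (b j) u v) as [w [Hw ->]]; try lra; auto.
    assert (Rabs (dS z) <= exp eps * Rabs (dS w)).
    { apply (Hder j); auto. eapply Rle_trans; [apply (Hnl j); auto|lra]. }
    assert (0 <= Rabs (y - x) * Rabs (v - u))
      by (apply Rmult_le_pos; apply Rabs_pos).
    nra. }
  assert (He3 : exp eps <= 3) by (eapply Rle_trans; [apply exp_le; exact He1|apply exp_le_3]).
  constructor.
  - exists l2. split; [exact Hl2|]. intros x [[j [Hj Hx]] _].
    destruct (HL j Hj). destruct (Hab j Hj). lra.
  - intros x [Hx _]. exact Hx.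
  - intros j x Hj Hx. apply CS_iff. exists j; auto.
  - intros j y Hj [[i [Hi Hy]] _]. destruct (Honto j Hj) as [_ Ho].
    apply Ho. destruct (HL i Hi). lra.
  - intros j Hj.
    destruct (Hab j Hj) as [Haj _].
    destruct (holder_same_sign dS (a j) (b j) H alpha) as [Hs|Hs]; try lra.
    + intros x y Hx Hy. apply (HH j); auto.
    + intros x Hx. apply Hgt. exists j; auto.
    + left. intros x y Hx Hxy Hy.
      destruct (mvt_within _ _ _ _ (HD j Hj) x y) as [z [Hz1 Hz2]]; try lra.
      specialize (Hs z ltac:(lra)). nra.
    + right. intros x y Hx Hxy Hy.
      destruct (mvt_within _ _ _ _ (HD j Hj) x y) as [z [Hz1 Hz2]]; try lra.
      specialize (Hs z ltac:(lra)). nra.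
  - intros j x y Hj Hx Hy.
    destruct (Honto j Hj) as [Hto Ho].
    specialize (Hlen j Hj). destruct (HL j Hj) as [HLa HLb].
    assert (Hgl : g <= l2 - l1 - (b j - a j)).
    { assert (exists i, (i < k)%nat /\ i <> j) as [i [Hi Hij]].
      { destruct j; [exists 1%nat|exists 0%nat]; lia. }
      destruct (HL i Hi). destruct (Hab i Hi). destruct (Hab j Hj).
      destruct (Rle_dec (a j) (a i)).
      - assert (b j < a i).
        { apply Rnot_le_lt. intro.
          specialize (Hsep i j (a i) (a i) Hi Hj Hij ltac:(lra) ltac:(lra)).
          rewrite Rminus_diag, Rabs_R0 in Hsep. lra. }
        specialize (Hsep i j (a i) (b j) Hi Hj Hij ltac:(lra) ltac:(lra)).
        rewrite Rabs_right in Hsep; lra.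
      - assert (b i < a j).
        { apply Rnot_le_lt. intro.
          specialize (Hsep i j (a j) (a j) Hi Hj Hij ltac:(lra) ltac:(lra)).
          rewrite Rminus_diag, Rabs_R0 in Hsep. lra. }
        specialize (Hsep i j (b i) (a j) Hi Hj Hij ltac:(lra) ltac:(lra)).
        rewrite Rabs_left in Hsep; lra. }
    split.
    (* Preimages of the two ends of [L] are compared with [x, y], so the orientation of the branch
       does not matter. *)
    + destruct (Ho l1 ltac:(lra)) as [u [Hu Eu]].
      destruct (Ho l2 ltac:(lra)) as [v [Hv Ev]].
      specialize (Hd1 j u v x y Hj Hu Hv Hx Hy).
      rewrite Eu, Ev in Hd1. rewrite (Rabs_right (l2 - l1)) in Hd1 by lra.
      rewrite (Rabs_minus_sym x y), (Rabs_minus_sym (S x)).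
      assert (Huv : Rabs (v - u) <= b j - a j) by (apply Rabs_le; lra).
      pose proof (Rabs_pos (y - x)). pose proof (Rabs_pos (S y - S x)).
      assert (G1 : (1 + g) * (b j - a j) <= l2 - l1) by nra.
      set (d := Rabs (y - x)) in *. set (D := Rabs (S y - S x)) in *.
      assert (G2 : (l2 - l1) * d <= exp eps * (D * (b j - a j))).
      { eapply Rle_trans; [exact Hd1|]. apply Rmult_le_compat_l; [left; apply exp_pos|].
        apply Rmult_le_compat_l; lra. }
      assert (G3 : (1 + g) * d <= exp eps * D).
      { apply Rmult_le_reg_l with (b j - a j); [lra|]. nra. }
      apply Rmult_le_reg_l with (exp eps); [apply exp_pos|]. nra.
    + specialize (Hd1 j x y (a j) (b j) Hj Hx Hy ltac:(lra) ltac:(lra)).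
      rewrite (Rabs_minus_sym x y), (Rabs_minus_sym (S x)).
      rewrite (Rabs_right (b j - a j)) in Hd1 by lra.
      assert (Rabs (S (b j) - S (a j)) <= 1).
      { pose proof (Hto (a j) ltac:(lra)). pose proof (Hto (b j) ltac:(lra)).
        apply Rabs_le; lra. }
      pose proof (Rabs_pos (y - x)). pose proof (Rabs_pos (S y - S x)).
      pose proof (Rabs_pos (S (b j) - S (a j))).
      apply Rmult_le_reg_r with la; [lra|].
      replace (3 / la * Rabs (y - x) * la) with (3 * Rabs (y - x)) by (field; lra).
      assert (Rabs (S (b j) - S (a j)) * Rabs (y - x) <= Rabs (y - x)) by nra.
      pose proof (exp_pos eps). nra.
  - intros j s t x y u v Hj Hs Hst Ht Hx Hy Hu Hv.
    pose proof (exp_pos (si * Rpower (t - s) (alpha / 2))).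
    destruct (Req_dec x y) as [->|Hxy].
    { rewrite !Rminus_diag, Rabs_R0. lra. }
    destruct (Req_dec u v) as [->|Huv].
    { rewrite !Rminus_diag, Rabs_R0. lra. }
    destruct (Hmvt j s t x y) as [z [Hz ->]]; try lra; auto.
    destruct (Hmvt j s t u v) as [w [Hw ->]]; try lra; auto.
    assert (Rabs (dS z) <= exp (si * Rpower (t - s) (alpha / 2)) * Rabs (dS w)).
    { apply (Hder j); auto; try lra.
      set (X := Rpower (t - s) (alpha / 2)).
      assert (HX : 0 < X) by apply exp_pos.
      assert (HXX : Rpower (t - s) alpha = X * X).
      { unfold X. rewrite <- Rpower_plus. f_equal. lra. }
      set (L := ln (Rabs (dS z) / Rabs (dS w))).
      destruct (Rle_dec L 0); [nra|].
      assert (A1 : L <= eps).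
      { unfold L. eapply Rle_trans; [apply (Hnl j); auto; lra|lra]. }
      assert (Hzw : z <> w).
      { intros ->. apply n. unfold L. rewrite Rdiv_diag, ln_1; [lra|].
        assert (0 < Rabs (dS w)) by (apply (Hnz j); auto; lra). lra. }
      (* [L <= eps] and [L <= M X^2], so [L] is below their geometric mean. *)
      assert (A2 : L <= M * (X * X)).
      { rewrite <- HXX. eapply Rle_trans; [apply Rle_abs|].
        eapply Rle_trans; [apply (Hlog j); auto; lra|].
        apply Rmult_le_compat_l; [lra|]. apply Rpower_le_base; try lra.
        - apply Rabs_pos_lt. lra.
        - apply Rabs_le. lra. }
      apply Rnot_lt_le. intro A3.
      assert (B1 : L * L <= eps * (M * (X * X))) by (apply Rmult_le_compat; lra).
      assert (B2 : eps * M * (X * X) <= si * si * (X * X)).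
      { apply Rmult_le_compat_r; [nra|exact HeM]. }
      assert (B3 : 0 < si * X) by (apply Rmult_lt_0_compat; lra).
      assert (B4 : si * X * (si * X) < L * L) by (apply Rmult_le_0_lt_compat; lra).
      lra. }
    assert (0 <= Rabs (y - x) * Rabs (v - u))
      by (apply Rmult_le_pos; apply Rabs_pos).
    nra.
  - exact Hsep.
Qed.

(** * Shapes of pairs of gaps *)

(** The ends are unordered because branches of [S] and lifts of circle maps may reverse
    orientation. *)
Definition gap (K : R -> Prop) (p q : R) : Prop :=
  K p /\ K q /\ p <> q /\ forall x, K x -> ~ (p < x < q) /\ ~ (q < x < p).

Record pts := Pts { p1 : R; p2 : R; p3 : R; p4 : R }.

Definition pmap (f : R -> R) (q : pts) : pts :=
  Pts (f (p1 q)) (f (p2 q)) (f (p3 q)) (f (p4 q)).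

Definition hull (q : pts) : R := Rabs (p4 q - p1 q).

Definition mono4 (q : pts) : Prop :=
  (p1 q < p2 q /\ p2 q < p3 q /\ p3 q < p4 q) \/
  (p4 q < p3 q /\ p3 q < p2 q /\ p2 q < p1 q).

Definition gap_pair (K : R -> Prop) (q : pts) : Prop :=
  gap K (p1 q) (p2 q) /\ gap K (p3 q) (p4 q) /\ mono4 q.

(** The two coordinates of a shape: the bridge between the gaps and the second gap, in units of the
    first gap. *)
Definition rB (q : pts) : R := Rabs (p3 q - p2 q) / Rabs (p2 q - p1 q).
Definition rG (q : pts) : R := Rabs (p4 q - p3 q) / Rabs (p2 q - p1 q).

(** Closeness is multiplicative here because distortion factors multiply along a blow-up; it becomes
    additive only when shapes are compared with cluster centres. *)
Definition cmp (f u v : R) : Prop := u <= f * v /\ v <= f * u.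

Definition cmp_shape (f : R) (q q' : pts) : Prop :=
  cmp f (rB q) (rB q') /\ cmp f (rG q) (rG q').

Lemma cmp_trans (f g u v w : R) :
  0 < f -> 0 < g -> cmp f u v -> cmp g v w -> cmp (f * g) u w.
Proof.
  intros Hf Hg [A B] [C D]. split.
  - apply Rle_trans with (f * v); [exact A|].
    rewrite Rmult_assoc. apply Rmult_le_compat_l; lra.
  - apply Rle_trans with (g * v); [exact D|].
    rewrite (Rmult_comm f), Rmult_assoc. apply Rmult_le_compat_l; lra.
Qed.

Lemma cmp_weaken (f g u v : R) : 0 <= u -> 0 <= v -> f <= g -> cmp f u v -> cmp g u v.
Proof. intros Hu Hv Hfg [A B]. split; nra. Qed.

Lemma shape_nonneg (q : pts) : mono4 q -> 0 <= rB q /\ 0 <= rG q.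
Proof.
  intros H. assert (0 < Rabs (p2 q - p1 q)) by (apply Rabs_pos_lt; destruct H; lra).
  split; apply Rmult_le_pos; auto using Rabs_pos; left; apply Rinv_0_lt_compat; exact H0.
Qed.

Lemma cmp_shape_trans (f g : R) (q q' q'' : pts) : 0 < f -> 0 < g ->
  cmp_shape f q q' -> cmp_shape g q' q'' -> cmp_shape (f * g) q q''.
Proof. intros Hf Hg [A B] [C D]. split; eapply cmp_trans; eassumption. Qed.

Lemma cmp_shape_weaken (f g : R) (q q' : pts) : mono4 q -> mono4 q' -> f <= g ->
  cmp_shape f q q' -> cmp_shape g q q'.
Proof.
  intros H H' Hfg [A B].
  destruct (shape_nonneg q H). destruct (shape_nonneg q' H').
  split; eapply cmp_weaken; eassumption.
Qed.

Lemma cmp_shape_refl (q : pts) : cmp_shape 1 q q.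
Proof. split; split; lra. Qed.

Lemma mono4_near (q : pts) (x : R) : mono4 q ->
  x = p1 q \/ x = p2 q \/ x = p3 q \/ x = p4 q ->
  Rmin (p1 q) (p4 q) <= x <= Rmax (p1 q) (p4 q).
Proof.
  intros H Hx.
  pose proof (Rmin_l (p1 q) (p4 q)). pose proof (Rmin_r (p1 q) (p4 q)).
  pose proof (Rmax_l (p1 q) (p4 q)). pose proof (Rmax_r (p1 q) (p4 q)).
  destruct H; intuition lra.
Qed.

Lemma hull_minmax (q : pts) : hull q = Rmax (p1 q) (p4 q) - Rmin (p1 q) (p4 q).
Proof.
  unfold hull, Rmax, Rmin, Rabs. destruct (Rle_dec _ _); destruct (Rcase_abs _); lra.
Qed.

Lemma hull_pos (q : pts) : mono4 q -> 0 < hull q.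
Proof. intros H. apply Rabs_pos_lt. destruct H; lra. Qed.

Lemma hull_sum (q : pts) : mono4 q -> hull q = Rabs (p2 q - p1 q) * (1 + rB q + rG q).
Proof.
  intros H. assert (0 < Rabs (p2 q - p1 q)) by (apply Rabs_pos_lt; destruct H; lra).
  unfold rB, rG.
  replace (Rabs (p2 q - p1 q) * _) with
    (Rabs (p2 q - p1 q) + Rabs (p3 q - p2 q) + Rabs (p4 q - p3 q)) by (field; lra).
  unfold hull. destruct H; [rewrite !Rabs_right by lra|rewrite !Rabs_left by lra]; lra.
Qed.

(** The distortion bound is cross-multiplied, so it makes sense for degenerate segments. Applied to
    a segment and the first gap in either order, it gives both halves of [cmp]. *)
Lemma cmp_shape_pmap (f : R) (S : R -> R) (q : pts) : mono4 q -> mono4 (pmap S q) ->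
  (forall x y u v, Rmin (p1 q) (p4 q) <= x <= Rmax (p1 q) (p4 q) ->
     Rmin (p1 q) (p4 q) <= y <= Rmax (p1 q) (p4 q) ->
     Rmin (p1 q) (p4 q) <= u <= Rmax (p1 q) (p4 q) ->
     Rmin (p1 q) (p4 q) <= v <= Rmax (p1 q) (p4 q) ->
     Rabs (S y - S x) * Rabs (v - u) <= f * (Rabs (S v - S u) * Rabs (y - x))) ->
  cmp_shape f q (pmap S q).
Proof.
  intros Hq HS H.
  assert (Hj : 0 < Rabs (p2 q - p1 q)) by (apply Rabs_pos_lt; destruct Hq; lra).
  assert (Hj' : 0 < Rabs (S (p2 q) - S (p1 q))).
  { apply Rabs_pos_lt. destruct HS as [HS|HS]; simpl in HS; lra. }
  assert (A : forall x y, Rmin (p1 q) (p4 q) <= x <= Rmax (p1 q) (p4 q) ->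
     Rmin (p1 q) (p4 q) <= y <= Rmax (p1 q) (p4 q) ->
     cmp f (Rabs (y - x) / Rabs (p2 q - p1 q))
       (Rabs (S y - S x) / Rabs (S (p2 q) - S (p1 q)))).
  { intros x y Hx Hy.
    assert (M1 := mono4_near q (p1 q) Hq ltac:(auto)).
    assert (M2 := mono4_near q (p2 q) Hq ltac:(auto)).
    split.
    - apply Rmult_le_reg_r with (Rabs (p2 q - p1 q) * Rabs (S (p2 q) - S (p1 q))); [nra|].
      replace (Rabs (y - x) / Rabs (p2 q - p1 q) * _) with
        (Rabs (S (p2 q) - S (p1 q)) * Rabs (y - x)) by (field; lra).
      replace (f * _ * _) with (f * (Rabs (S y - S x) * Rabs (p2 q - p1 q))) by (field; lra).
      apply H; auto.
    - apply Rmult_le_reg_r with (Rabs (p2 q - p1 q) * Rabs (S (p2 q) - S (p1 q))); [nra|].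
      replace (Rabs (S y - S x) / Rabs (S (p2 q) - S (p1 q)) * _) with
        (Rabs (S y - S x) * Rabs (p2 q - p1 q)) by (field; lra).
      replace (f * _ * _) with (f * (Rabs (S (p2 q) - S (p1 q)) * Rabs (y - x))) by (field; lra).
      apply H; auto. }
  split; apply A; apply mono4_near; auto.
Qed.

Lemma gap_sym (K : R -> Prop) (p q : R) : gap K p q -> gap K q p.
Proof.
  intros (A & B & N & H). repeat split; auto; try (destruct (H x); auto).
Qed.

(** The ends are the last point of [K] up to [z] and the first one after it; the free stretch [d]
    keeps the latter away from [z]. *)
Lemma gap_extremal (K : R -> Prop) (z : R) (hi lo : R) :
  (forall x, (forall e, 0 < e -> exists y, K y /\ Rabs (x - y) < e) -> K x) ->
  K lo -> lo <= z -> K hi -> z < hi ->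
  (exists d, 0 < d /\ forall x, K x -> z < x -> z + d <= x) ->
  exists u v, gap K u v /\ lo <= u <= z /\ z < v.
Proof.
  intros Hc Hlo Hlz Hhi Hzh [d [Hd Hz]].
  destruct (completeness (fun x => K x /\ x <= z)) as [u [Hu1 Hu2]].
  { exists z. intros x [_ Hx]. exact Hx. }
  { exists lo. auto. }
  (* An infimum, taken as the least upper bound of the reflected set; the right end is [- v]. *)
  destruct (completeness (fun x => K (- x) /\ z < - x)) as [v [Hv1 Hv2]].
  { exists (- z). intros x [_ Hx]. lra. }
  { exists (- hi). rewrite Ropp_involutive. auto. }
  assert (Huz : u <= z) by (apply Hu2; intros x [_ Hx]; exact Hx).
  assert (Hvz : v <= - (z + d)).
  { apply Hv2. intros x [Hx1 Hx2]. specialize (Hz _ Hx1 Hx2). lra. }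
  assert (Ku : K u).
  { apply Hc. intros e He. apply NNPP. intro Hn.
    assert (u <= u - e); [|lra]. apply Hu2. intros x [Hx1 Hx2].
    apply Rnot_lt_le. intro Hlt. apply Hn. exists x. split; [exact Hx1|].
    assert (x <= u) by (apply Hu1; auto). rewrite Rabs_right; lra. }
  assert (Kv : K (- v)).
  { apply Hc. intros e He. apply NNPP. intro Hn.
    assert (v <= v - e); [|lra]. apply Hv2. intros x [Hx1 Hx2].
    apply Rnot_lt_le. intro Hlt. apply Hn. exists (- x). split; [exact Hx1|].
    assert (x <= v) by (apply Hv1; auto). rewrite Rabs_left1; lra. }
  exists u, (- v). split; [|split; [split; [apply Hu1; auto|exact Huz]|lra]].
  repeat split; auto; try lra.
  intros [Hx1 Hx2]. destruct (Rle_dec x z) as [Hxz|Hxz].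
  - assert (x <= u) by (apply Hu1; auto). lra.
  - assert (- x <= v) by (apply Hv1; rewrite Ropp_involutive; split; [auto|lra]). lra.
Qed.

Lemma pow_unbounded (mu x : R) : 1 < mu -> 0 < x -> exists n, 1 < x * mu ^ n.
Proof.
  intros Hmu Hx. destruct (Pow_x_infinity mu) with (b := 2 / x) as [n Hn].
  { rewrite Rabs_right; lra. }
  exists n. specialize (Hn n (le_n _)).
  rewrite Rabs_right in Hn by (apply Rle_ge, pow_le; lra).
  apply Rge_le in Hn. apply Rmult_le_compat_l with (r := x) in Hn; [|lra].
  replace (x * (2 / x)) with 2 in Hn by (field; lra). lra.
Qed.

(** * Blowing up gaps and gap pairs through the branches *)

Section Branches.
Variables (k : nat) (a b : nat -> R) (S : R -> R) (C : R -> Prop) (g mu La si be : R).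
Hypothesis Hbr : branches k a b S C g mu La si be.
Hypotheses (Hk : (2 <= k)%nat) (Hg : 0 < g < 1) (Hmu : 1 < mu) (HLa : 0 < La)
  (Hbe : 0 < be).

Lemma C_diff (x y : R) : C x -> C y -> Rabs (x - y) < 1.
Proof.
  intros Hx Hy. destruct (br_unit _ _ _ _ _ _ _ _ _ _ Hbr) as [h [Hh H]].
  pose proof (H x Hx). pose proof (H y Hy). apply Rabs_def1; lra.
Qed.

Lemma S_between (j : nat) (x y z : R) : (j < k)%nat ->
  a j <= x <= b j -> a j <= y <= b j -> a j <= z <= b j ->
  S x < S z < S y -> x < z < y \/ y < z < x.
Proof.
  intros Hj Hx Hy Hz H.
  destruct (br_mono _ _ _ _ _ _ _ _ _ _ Hbr j Hj) as [Hm|Hm].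
  - left. split; apply Rnot_le_lt; intros [Hle|Hle].
    + specialize (Hm z x). lra.
    + subst. lra.
    + specialize (Hm y z). lra.
    + subst. lra.
  - right. split; apply Rnot_le_lt; intros [Hle|Hle].
    + specialize (Hm z y). lra.
    + subst. lra.
    + specialize (Hm x z). lra.
    + subst. lra.
Qed.

(** A branch is monotone and carries the part of [C] in its interval onto all of [C], so a point of
    [C] between the images comes from one between [p] and [q], and conversely. *)
Lemma gap_S (j : nat) (p q : R) : (j < k)%nat -> a j <= p <= b j -> a j <= q <= b j ->
  (gap C p q <-> gap C (S p) (S q)).
Proof.
  intros Hj Hp Hq.
  pose proof (br_iff _ _ _ _ _ _ _ _ _ _ Hbr j p Hj Hp) as Ip.
  pose proof (br_iff _ _ _ _ _ _ _ _ _ _ Hbr j q Hj Hq) as Iq.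
  pose proof (br_mono _ _ _ _ _ _ _ _ _ _ Hbr j Hj) as Hm.
  split; intros (A & B & N & H).
  - split; [tauto|]. split; [tauto|]. split.
    + intro E. destruct (Rdichotomy _ _ N); destruct Hm as [Hm|Hm];
        first [specialize (Hm p q); lra | specialize (Hm q p); lra].
    + intros y Hy. destruct (br_onto _ _ _ _ _ _ _ _ _ _ Hbr j y Hj Hy) as [x [Hx E]].
      rewrite <- E in Hy. apply (br_iff _ _ _ _ _ _ _ _ _ _ Hbr j x Hj Hx) in Hy.
      subst y. destruct (H x Hy).
      split; intro Hb;
        [destruct (S_between j p q x Hj Hp Hq Hx Hb)|destruct (S_between j q p x Hj Hq Hp Hx Hb)];
        auto.
  - split; [tauto|]. split; [tauto|]. split.
    + intro E. subst. auto.
    + intros x Hx.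
      split; intro Hb.
      * assert (Hxj : a j <= x <= b j) by lra.
        apply (br_iff _ _ _ _ _ _ _ _ _ _ Hbr j x Hj Hxj) in Hx.
        destruct (H _ Hx). destruct Hm as [Hm|Hm];
          pose proof (Hm p x); pose proof (Hm x q); lra.
      * assert (Hxj : a j <= x <= b j) by lra.
        apply (br_iff _ _ _ _ _ _ _ _ _ _ Hbr j x Hj Hxj) in Hx.
        destruct (H _ Hx). destruct Hm as [Hm|Hm];
          pose proof (Hm q x); pose proof (Hm x p); lra.
Qed.

Lemma gap_image (j : nat) (p q : R) : (j < k)%nat -> a j <= p <= b j -> a j <= q <= b j ->
  gap C p q -> gap C (S p) (S q).
Proof. intros Hj Hp Hq. apply (gap_S j p q); assumption. Qed.

Lemma gap_preimage (j : nat) (p q : R) : (j < k)%nat -> a j <= p <= b j -> a j <= q <= b j ->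
  gap C (S p) (S q) -> gap C p q.
Proof. intros Hj Hp Hq. apply (gap_S j p q); assumption. Qed.

Lemma mono4_S (j : nat) (q : pts) : (j < k)%nat ->
  (forall x, x = p1 q \/ x = p2 q \/ x = p3 q \/ x = p4 q -> a j <= x <= b j) ->
  (mono4 q <-> mono4 (pmap S q)).
Proof.
  intros Hj Hin.
  assert (H1 := Hin (p1 q) ltac:(auto)). assert (H2 := Hin (p2 q) ltac:(auto)).
  assert (H3 := Hin (p3 q) ltac:(auto)). assert (H4 := Hin (p4 q) ltac:(auto)).
  split.
  - destruct (br_mono _ _ _ _ _ _ _ _ _ _ Hbr j Hj) as [Hm|Hm];
    (intros [H|H]; [pose proof (Hm (p1 q) (p2 q)); pose proof (Hm (p2 q) (p3 q));
        pose proof (Hm (p3 q) (p4 q))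
      |pose proof (Hm (p2 q) (p1 q)); pose proof (Hm (p3 q) (p2 q));
        pose proof (Hm (p4 q) (p3 q))]); unfold mono4, pmap; simpl;
      [left|right|right|left]; repeat split; intuition lra.
  - unfold mono4, pmap; simpl. intros H.
    assert (A1 : p1 q < p2 q < p3 q \/ p3 q < p2 q < p1 q).
    { destruct H; [apply (S_between j); auto; lra|].
      destruct (S_between j (p3 q) (p1 q) (p2 q) Hj); auto; lra. }
    assert (A2 : p2 q < p3 q < p4 q \/ p4 q < p3 q < p2 q).
    { destruct H; [apply (S_between j); auto; lra|].
      destruct (S_between j (p4 q) (p2 q) (p3 q) Hj); auto; lra. }
    destruct A1; destruct A2; [left|..|right]; lra.
Qed.

Lemma pair_S (j : nat) (q : pts) : (j < k)%nat ->
  a j <= p1 q <= b j -> a j <= p4 q <= b j -> gap_pair C q ->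
  gap_pair C (pmap S q) /\ cmp_shape (exp (si * Rpower (hull q) be)) q (pmap S q) /\
  mu * hull q <= hull (pmap S q).
Proof.
  intros Hj H1 H4 (G1 & G2 & Hm).
  assert (Hin : forall x, x = p1 q \/ x = p2 q \/ x = p3 q \/ x = p4 q -> a j <= x <= b j).
  { intros x Hx. destruct Hm as [Hm|Hm]; destruct Hx as [-> |[-> |[-> | ->]]]; lra. }
  assert (Hm' : mono4 (pmap S q)) by (apply (mono4_S j q); auto).
  split; [|split].
  - split; [apply (gap_image j); auto|]. split; [apply (gap_image j); auto|exact Hm'].
  - apply cmp_shape_pmap; auto. intros x y u v Hx Hy Hu Hv.
    rewrite hull_minmax.
    apply (br_dist _ _ _ _ _ _ _ _ _ _ Hbr j); auto.
    + unfold Rmin. destruct (Rle_dec _ _); lra.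
    + pose proof (hull_pos q Hm). rewrite hull_minmax in H. lra.
    + unfold Rmax. destruct (Rle_dec _ _); lra.
  - apply (br_expand _ _ _ _ _ _ _ _ _ _ Hbr j); auto.
Qed.

(** A companion of [S x] pulls back, along the branch of [x], to a companion of [x] that is closer
    by the factor [mu]. The recursion starts from a preimage of [x] in a branch other than its
    own. *)
Lemma C_perfect (x e : R) : C x -> 0 < e -> exists y, C y /\ y <> x /\ Rabs (y - x) < e.
Proof.
  intros Hx He.
  assert (H : forall n x, C x -> exists y, C y /\ y <> x /\ Rabs (y - x) * mu ^ n <= 1).
  { clear x Hx. induction n as [|n IH]; intros x Hx.
    - destruct (br_in _ _ _ _ _ _ _ _ _ _ Hbr x Hx) as [i [Hi Hxi]].
      assert (exists j, (j < k)%nat /\ i <> j) as [j [Hj Hij]].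
      { destruct i; [exists 1%nat|exists 0%nat]; lia. }
      destruct (br_onto _ _ _ _ _ _ _ _ _ _ Hbr j x Hj Hx) as [y [Hy E]].
      assert (Cy : C y) by (apply (br_iff _ _ _ _ _ _ _ _ _ _ Hbr j y Hj Hy); rewrite E; exact Hx).
      exists y. split; [exact Cy|]. split.
      + intros ->. pose proof (br_sep _ _ _ _ _ _ _ _ _ _ Hbr i j x x Hi Hj Hij Hxi Hy).
        rewrite Rminus_diag, Rabs_R0 in H. lra.
      + simpl. pose proof (C_diff y x Cy Hx). lra.
    - destruct (br_in _ _ _ _ _ _ _ _ _ _ Hbr x Hx) as [j [Hj Hxj]].
      assert (CS : C (S x)) by (apply (br_iff _ _ _ _ _ _ _ _ _ _ Hbr j x Hj Hxj); exact Hx).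
      destruct (IH (S x) CS) as [y' [Cy' [Ny' Hy']]].
      destruct (br_onto _ _ _ _ _ _ _ _ _ _ Hbr j y' Hj Cy') as [y [Hy E]].
      exists y. split.
      + apply (br_iff _ _ _ _ _ _ _ _ _ _ Hbr j y Hj Hy). rewrite E. exact Cy'.
      + split; [intros ->; auto|].
        pose proof (br_expand _ _ _ _ _ _ _ _ _ _ Hbr j y x Hj Hy Hxj) as [Hex _].
        rewrite E in Hex. simpl.
        assert (0 < mu ^ n) by (apply pow_lt; lra). nra. }
  destruct (pow_unbounded mu e Hmu He) as [n Hn].
  destruct (H n x Hx) as [y [Cy [Ny Hy]]]. exists y. split; [exact Cy|]. split; [exact Ny|].
  assert (0 < mu ^ n) by (apply pow_lt; lra). nra.
Qed.

(* One step costs [si * l ^ be] and multiplies [l] by at least [mu], so the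
   total cost telescopes against the potential [Q * l ^ be]. *)
Lemma potential_step (Q l l' lf : R) : si <= Q * (Rpower mu be - 1) -> 0 < Q ->
  0 < l -> mu * l <= l' ->
  exp (si * Rpower l be) * exp (Q * (Rpower lf be - Rpower l' be)) <=
  exp (Q * (Rpower lf be - Rpower l be)).
Proof.
  intros HQ HQ0 Hl Hl'. rewrite <- exp_plus. apply exp_le.
  assert (Rpower mu be * Rpower l be <= Rpower l' be).
  { rewrite Rpower_mult_distr by lra. apply Rpower_le_base; [nra|exact Hl'|exact Hbe]. }
  assert (0 < Rpower l be) by apply exp_pos.
  assert (si * Rpower l be <= Q * (Rpower mu be - 1) * Rpower l be)
    by (apply Rmult_le_compat_r; lra).
  assert (Q * (Rpower mu be * Rpower l be) <= Q * Rpower l' be)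
    by (apply Rmult_le_compat_l; lra).
  lra.
Qed.

Lemma potential_bound (Q l lf : R) : 0 < Q -> 0 < lf < 1 ->
  exp (Q * (Rpower lf be - Rpower l be)) <= exp Q.
Proof.
  intros HQ Hf. apply exp_le.
  assert (0 < Rpower l be) by apply exp_pos.
  assert (Rpower lf be <= 1).
  { replace 1 with (Rpower 1 be) by (unfold Rpower; rewrite ln_1, Rmult_0_r; apply exp_0).
    apply Rpower_le_base; lra. }
  nra.
Qed.

(** The pair is iterated until its outer ends fall into different intervals; then [br_sep] bounds
    the hull from below. This happens because each earlier step multiplies the hull by at least
    [mu], while hulls stay below 1. *)
Lemma pair_blowup (Q : R) (q : pts) : si <= Q * (Rpower mu be - 1) -> 0 < Q ->
  gap_pair C q ->
  exists q', gap_pair C q' /\ g <= hull q' /\ cmp_shape (exp Q) q q'.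
Proof.
  intros HQ HQ0 Hq.
  (* The factor keeps the exact potential difference, so that induction composes without loss;
     [potential_bound] reduces it to [exp Q] at the end. *)
  assert (H : forall n q, gap_pair C q -> 1 < hull q * mu ^ n ->
    exists q', gap_pair C q' /\ g <= hull q' /\
      cmp_shape (exp (Q * (Rpower (hull q') be - Rpower (hull q) be))) q q').
  { clear q Hq. induction n as [|n IH]; intros q Hq Hn.
    - destruct Hq as ((C1 & _) & (_ & C4 & _) & _).
      pose proof (C_diff _ _ C4 C1). unfold hull in Hn. simpl in Hn. lra.
    - assert (Hq' := Hq). destruct Hq' as ((C1 & _) & (_ & C4 & _) & Hm).
      destruct (br_in _ _ _ _ _ _ _ _ _ _ Hbr _ C1) as [i [Hi H1]].
      destruct (br_in _ _ _ _ _ _ _ _ _ _ Hbr _ C4) as [j [Hj H4]].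
      destruct (Nat.eq_dec i j) as [<-|Hij].
      + destruct (pair_S i q Hi H1 H4 Hq) as [Hq' [Hc Hh]].
        destruct (IH (pmap S q) Hq') as [q' [G1 [G2 G3]]].
        { eapply Rlt_le_trans; [exact Hn|]. simpl.
          assert (0 < mu ^ n) by (apply pow_lt; lra). nra. }
        exists q'. split; [exact G1|]. split; [exact G2|].
        eapply cmp_shape_weaken; [exact Hm|apply G1| |].
        2:{ eapply cmp_shape_trans; [| |exact Hc|exact G3]; apply exp_pos. }
        apply potential_step; auto. apply hull_pos; exact Hm.
      + exists q. split; [exact Hq|]. split.
        * apply (br_sep _ _ _ _ _ _ _ _ _ _ Hbr j i); auto.
        * rewrite Rminus_diag, Rmult_0_r, exp_0. apply cmp_shape_refl. }
  destruct (pow_unbounded mu (hull q) Hmu (hull_pos q ltac:(apply Hq))) as [n Hn].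
  destruct (H n q Hq Hn) as [q' [G1 [G2 G3]]].
  exists q'. split; [exact G1|]. split; [exact G2|].
  eapply cmp_shape_weaken; [apply Hq|apply G1| |exact G3].
  apply potential_bound; auto. split; [apply hull_pos, G1|].
  destruct G1 as ((C1 & _) & (_ & C4 & _) & _). apply C_diff; auto.
Qed.

Hypothesis Hclosed :
  forall x, (forall e, 0 < e -> exists y, C y /\ Rabs (x - y) < e) -> C x.

(** The gap that straddles the right end of some interval: the next point of [C] belongs to another
    interval, hence is at least [g] further. *)
Lemma big_gap (c : R) : C c -> exists u v, gap C u v /\ g <= Rabs (v - u).
Proof.
  intros Hc.
  assert (H : forall i j x y, (i < k)%nat -> (j < k)%nat -> i <> j ->
    C x -> C y -> a i <= x <= b i -> a j <= y <= b j -> x < y ->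
    exists u v, gap C u v /\ g <= Rabs (v - u)).
  { intros i j x y Hi Hj Hij Cx Cy Hx Hy Hxy.
    assert (Hby : b i < y).
    { apply Rnot_le_lt. intro Hle.
      pose proof (br_sep _ _ _ _ _ _ _ _ _ _ Hbr i j y y Hi Hj Hij ltac:(lra) Hy).
      rewrite Rminus_diag, Rabs_R0 in H. lra. }
    assert (Hfar : forall z, C z -> b i < z -> b i + g <= z).
    { intros z Cz Hz. destruct (br_in _ _ _ _ _ _ _ _ _ _ Hbr z Cz) as [m [Hm Hzm]].
      assert (Him : i <> m) by (intros ->; lra).
      pose proof (br_sep _ _ _ _ _ _ _ _ _ _ Hbr i m (b i) z Hi Hm Him ltac:(lra) Hzm) as Hs.
      rewrite Rabs_left in Hs; lra. }
    destruct (gap_extremal C (b i) y x Hclosed Cx ltac:(lra) Cy Hby) as [u [v [Huv [Hu Hv]]]].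
    { exists g. split; [lra|exact Hfar]. }
    exists u, v. split; [exact Huv|].
    specialize (Hfar v ltac:(apply Huv) Hv). rewrite Rabs_right; lra. }
  destruct (br_onto _ _ _ _ _ _ _ _ _ _ Hbr 0%nat c ltac:(lia) Hc) as [x [Hx Ex]].
  destruct (br_onto _ _ _ _ _ _ _ _ _ _ Hbr 1%nat c ltac:(lia) Hc) as [y [Hy Ey]].
  assert (Cx : C x).
  { apply (br_iff _ _ _ _ _ _ _ _ _ _ Hbr 0%nat x); [lia|exact Hx|rewrite Ex; exact Hc]. }
  assert (Cy : C y).
  { apply (br_iff _ _ _ _ _ _ _ _ _ _ Hbr 1%nat y); [lia|exact Hy|rewrite Ey; exact Hc]. }
  destruct (Rtotal_order x y) as [Hxy|[Hxy|Hxy]].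
  - apply (H 0%nat 1%nat x y); auto; lia.
  - subst y. pose proof (br_sep _ _ _ _ _ _ _ _ _ _ Hbr 0%nat 1%nat x x ltac:(lia) ltac:(lia) ltac:(lia) Hx Hy).
    rewrite Rminus_diag, Rabs_R0 in H0. lra.
  - apply (H 1%nat 0%nat y x); auto; lia.
Qed.

(** A gap whose ends lie in different intervals gets as partner the preimage of a big gap under the
    branch containing [q]. It lies beyond [q], since that interval does not contain [p]. *)
Lemma gap_neighbour_split (i j : nat) (p q : R) : (i < k)%nat -> (j < k)%nat -> i <> j ->
  a i <= p <= b i -> a j <= q <= b j -> gap C p q ->
  exists x y, gap_pair C (Pts p q x y) /\ g / La <= Rabs (y - x) /\ a j <= x <= b j /\ a j <= y <= b j.
Proof.
  intros Hi Hj Hij Hp Hq Hpq.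
  assert (Cq : C q) by apply Hpq. assert (Cp : C p) by apply Hpq.
  destruct (big_gap q Cq) as [u [v [Huv Hl]]].
  destruct (br_onto _ _ _ _ _ _ _ _ _ _ Hbr j u Hj ltac:(apply Huv)) as [x [Hx Ex]].
  destruct (br_onto _ _ _ _ _ _ _ _ _ _ Hbr j v Hj ltac:(apply Huv)) as [y [Hy Ey]].
  assert (Hxy : gap C x y) by (apply (gap_preimage j); auto; rewrite Ex, Ey; exact Huv).
  assert (Hlen : g / La <= Rabs (y - x)).
  { destruct (br_expand _ _ _ _ _ _ _ _ _ _ Hbr j y x Hj Hy Hx) as [_ Hex].
    rewrite Ex, Ey in Hex. apply Rmult_le_reg_l with La; [exact HLa|].
    replace (La * (g / La)) with g by (field; lra). lra. }
  assert (Hpj : ~ a j <= p <= b j).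
  { intro Hpj. pose proof (br_sep _ _ _ _ _ _ _ _ _ _ Hbr i j p p Hi Hj Hij Hp Hpj) as Hs.
    rewrite Rminus_diag, Rabs_R0 in Hs. lra. }
  (* Two gaps on either side of [q] would isolate [q] in [C]. Hence the bridge between the gaps has
     positive length. *)
  assert (Hne : forall z w, a j <= z <= b j -> a j <= w <= b j -> gap C z w -> z <> q).
  { intros z w Hz Hw Hzw ->. assert (Cw : C w) by apply Hzw.
    set (e := Rmin (Rabs (q - p)) (Rabs (w - q))).
    assert (He : 0 < e).
    { destruct Hpq as (_ & _ & N1 & _). destruct Hzw as (_ & _ & N2 & _).
      apply Rmin_pos; apply Rabs_pos_lt; lra. }
    destruct (C_perfect q e Cq He) as [t [Ct [Nt Ht]]].
    pose proof (Rmin_l (Rabs (q - p)) (Rabs (w - q))).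
    pose proof (Rmin_r (Rabs (q - p)) (Rabs (w - q))).
    fold e in H, H0.
    destruct Hpq as (_ & _ & N1 & H1). destruct Hzw as (_ & _ & N2 & H2).
    destruct (H1 t Ct) as [A1 A2]. destruct (H2 t Ct) as [B1 B2].
    apply Rabs_def2 in Ht.
    destruct (Rlt_dec p (a j)).
    - rewrite (Rabs_right (q - p)) in H by lra.
      destruct (Rdichotomy _ _ N2).
      + rewrite (Rabs_right (w - q)) in H0 by lra. lra.
      + destruct (H1 w) as [A3 A4]; [|lra].
        assumption.
    - rewrite (Rabs_left (q - p)) in H by lra.
      destruct (Rdichotomy _ _ N2).
      + destruct (H1 w) as [A3 A4]; [|lra].
        assumption.
      + rewrite (Rabs_left (w - q)) in H0 by lra. lra. }
  assert (Nx : x <> q) by (apply (Hne x y); auto).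
  assert (Ny : y <> q) by (apply (Hne y x); auto using gap_sym).
  assert (Hxy' := Hxy). destruct Hxy' as (Cx & Cy & N & _).
  assert (Hpq' := Hpq). destruct Hpq' as (_ & _ & N1 & H1).
  destruct (H1 x Cx) as [A1 A2]. destruct (H1 y Cy) as [B1 B2].
  assert (HH : mono4 (Pts p q x y) \/ mono4 (Pts p q y x)).
  { unfold mono4; simpl. lra. }
  destruct HH as [HH|HH].
  - exists x, y. repeat (split; auto).
  - exists y, x. rewrite Rabs_minus_sym. repeat (split; auto using gap_sym); apply gap_sym; auto.
Qed.

(** The gap is blown up until its ends separate, a partner is chosen there, and the partner is
    pulled back along the same branches. At the last stage all lengths are below 1 and the first gap
    is at least [g], which gives the bounds up to the distortion [exp Q]. *)
Lemma gap_neighbour (Q p q : R) : si <= Q * (Rpower mu be - 1) -> 0 < Q ->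
  gap C p q ->
  exists x y, gap_pair C (Pts p q x y) /\
    rB (Pts p q x y) <= exp Q / g /\ rG (Pts p q x y) <= exp Q / g /\
    g / La <= exp Q * rG (Pts p q x y).
Proof.
  intros HQ HQ0 Hpq.
  assert (H : forall n p q, gap C p q -> 1 < Rabs (q - p) * mu ^ n ->
    exists x y q', gap_pair C (Pts p q x y) /\ gap_pair C q' /\
      rB q' <= 1 / g /\ rG q' <= 1 / g /\ g / La <= rG q' /\
      cmp_shape (exp (Q * (Rpower (hull q') be - Rpower (hull (Pts p q x y)) be)))
        (Pts p q x y) q').
  { clear p q Hpq. induction n as [|n IH]; intros p q Hpq Hn.
    - destruct Hpq as (Cp & Cq & _). pose proof (C_diff _ _ Cq Cp). simpl in Hn. lra.
    - destruct (br_in _ _ _ _ _ _ _ _ _ _ Hbr p ltac:(apply Hpq)) as [i [Hi Hp]].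
      destruct (br_in _ _ _ _ _ _ _ _ _ _ Hbr q ltac:(apply Hpq)) as [j [Hj Hq]].
      destruct (Nat.eq_dec i j) as [<-|Hij].
      + destruct (IH (S p) (S q)) as [x' [y' [q' (G1 & G2 & G3 & G4 & G5 & G6)]]].
        { apply (gap_image i); auto. }
        { eapply Rlt_le_trans; [exact Hn|].
          destruct (br_expand _ _ _ _ _ _ _ _ _ _ Hbr i q p Hi Hq Hp) as [Hex _].
          simpl. assert (0 < mu ^ n) by (apply pow_lt; lra). nra. }
        assert (G1' := G1). destruct G1' as (_ & (Cx & Cy & _) & _). simpl in Cx, Cy.
        destruct (br_onto _ _ _ _ _ _ _ _ _ _ Hbr i x' Hi Cx) as [x [Hx Ex]].
        destruct (br_onto _ _ _ _ _ _ _ _ _ _ Hbr i y' Hi Cy) as [y [Hy Ey]].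
        subst x' y'.
        change (Pts (S p) (S q) (S x) (S y)) with (pmap S (Pts p q x y)) in *.
        assert (Hpair : gap_pair C (Pts p q x y)).
        { split; [exact Hpq|]. split; [apply (gap_preimage i); auto; apply G1|].
          apply (mono4_S i (Pts p q x y)); [exact Hi| |apply G1].
          simpl. intros z [-> |[-> |[-> | ->]]]; assumption. }
        destruct (pair_S i (Pts p q x y) Hi Hp Hy Hpair) as [_ [Hc Hh]].
        exists x, y, q'. repeat (split; [assumption|]).
        eapply cmp_shape_weaken; [apply Hpair|apply G2| |].
        2:{ eapply cmp_shape_trans; [| |exact Hc|exact G6]; apply exp_pos. }
        apply potential_step; auto. apply hull_pos, Hpair.
      + destruct (gap_neighbour_split i j p q Hi Hj Hij Hp Hq Hpq) as [x [y [G1 [G2 _]]]].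
        exists x, y, (Pts p q x y). split; [exact G1|]. split; [exact G1|].
        assert (Hl : g <= Rabs (q - p)) by (apply (br_sep _ _ _ _ _ _ _ _ _ _ Hbr j i); auto).
        assert (Hb : forall z w, C z -> C w -> Rabs (w - z) / Rabs (q - p) <= 1 / g).
        { intros z w Cz Cw. pose proof (C_diff w z Cw Cz).
          apply Rmult_le_reg_r with (Rabs (q - p) * g); [nra|].
          replace (Rabs (w - z) / Rabs (q - p) * (Rabs (q - p) * g)) with (Rabs (w - z) * g)
            by (field; lra).
          replace (1 / g * (Rabs (q - p) * g)) with (Rabs (q - p)) by (field; lra).
          pose proof (Rabs_pos (w - z)). nra. }
        assert (G1' := G1). destruct G1' as ((Cp & Cq & _) & (Cx & Cy & _) & _).
        simpl in *.
        repeat split.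
        * apply Hb; auto.
        * apply Hb; auto.
        * unfold rG; simpl. pose proof (C_diff q p Cq Cp).
          pose proof (Rabs_pos (y - x)).
          apply Rmult_le_reg_r with (Rabs (q - p)); [lra|].
          replace (Rabs (y - x) / Rabs (q - p) * Rabs (q - p)) with (Rabs (y - x)) by (field; lra).
          assert (0 < g / La) by (apply Rdiv_lt_0_compat; lra). nra.
        * rewrite Rminus_diag, Rmult_0_r, exp_0, Rmult_1_l. lra.
        * rewrite Rminus_diag, Rmult_0_r, exp_0, Rmult_1_l. lra.
        * rewrite Rminus_diag, Rmult_0_r, exp_0, Rmult_1_l. lra.
        * rewrite Rminus_diag, Rmult_0_r, exp_0, Rmult_1_l. lra. }
  assert (Hpos : 0 < Rabs (q - p)).
  { destruct Hpq as (_ & _ & N & _). apply Rabs_pos_lt. lra. }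
  destruct (pow_unbounded mu _ Hmu Hpos) as [n Hn].
  destruct (H n p q Hpq Hn) as [x [y [q' (G1 & G2 & G3 & G4 & G5 & G6)]]].
  exists x, y. split; [exact G1|].
  assert (G7 : cmp_shape (exp Q) (Pts p q x y) q').
  { eapply cmp_shape_weaken; [apply G1|apply G2| |exact G6].
    apply potential_bound; auto. split; [apply hull_pos, G2|].
    destruct G2 as ((C1 & _) & (_ & C4 & _) & _). apply C_diff; auto. }
  destruct G7 as [[A1 A2] [B1 B2]]. pose proof (exp_pos Q) as He.
  replace (exp Q / g) with (exp Q * (1 / g)) by (field; lra).
  repeat split.
  - eapply Rle_trans; [exact A1|]. apply Rmult_le_compat_l; lra.
  - eapply Rle_trans; [exact B1|]. apply Rmult_le_compat_l; lra.
  - lra.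
Qed.

End Branches.

(** * Clusters of shapes *)

Lemma exists_INR_gt (x : R) : exists m, (0 < m)%nat /\ x < INR m.
Proof.
  destruct (INR_archimed 1 x ltac:(lra)) as [n Hn].
  exists (Datatypes.S n). split; [lia|]. rewrite S_INR. lra.
Qed.

Definition inside (p q x : R) : Prop := p < x < q \/ q < x < p.

Lemma grid_inside (m : nat) (c h p q : R) : (0 < m)%nat -> 1 < INR m * c ->
  0 <= p <= h -> 0 <= q <= h -> c <= Rabs (q - p) ->
  exists i, INR i <= INR m * h /\ inside p q (INR i / INR m).
Proof.
  intros Hm Hc.
  assert (Hm0 : 0 < INR m) by (apply lt_0_INR; exact Hm).
  assert (H : forall p q, 0 <= p -> p < q -> q <= h -> c <= q - p ->
    exists i, INR i <= INR m * h /\ p < INR i / INR m < q).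
  { intros x y Hx Hxy Hy Hl.
    destruct (archimed (INR m * x)) as [A1 A2].
    assert (Hpos : (0 <= up (INR m * x))%Z).
    { apply le_IZR. assert (0 <= INR m * x) by nra. lra. }
    exists (Z.to_nat (up (INR m * x))).
    rewrite INR_IZR_INZ, Z2Nat.id by exact Hpos.
    split; [nra|]. split.
    - apply Rmult_lt_reg_l with (INR m); [lra|].
      replace (INR m * (IZR (up (INR m * x)) / INR m)) with (IZR (up (INR m * x))) by (field; lra).
      lra.
    - apply Rmult_lt_reg_l with (INR m); [lra|].
      replace (INR m * (IZR (up (INR m * x)) / INR m)) with (IZR (up (INR m * x))) by (field; lra).
      nra. }
  intros Hp Hq Hl. destruct (Rle_dec p q).
  - rewrite Rabs_right in Hl by lra.
    destruct (Req_dec p q) as [->|]; [nra|].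
    destruct (H p q) as [i [A B]]; try lra. exists i. split; [exact A|left; exact B].
  - rewrite Rabs_left in Hl by lra.
    destruct (H q p) as [i [A B]]; try lra. exists i. split; [exact A|right; exact B].
Qed.

Lemma gap_unique (K : R -> Prop) (p q p' q' x : R) : gap K p q -> gap K p' q' ->
  inside p q x -> inside p' q' x -> (p = p' /\ q = q') \/ (p = q' /\ q = p').
Proof.
  intros (Kp & Kq & N & H) (Kp' & Kq' & N' & H') Hx Hx'.
  pose proof (H p' Kp'). pose proof (H q' Kq'). pose proof (H' p Kp). pose proof (H' q Kq).
  destruct Hx; destruct Hx'; lra.
Qed.

(** The two marked points determine each gap up to swapping its ends; their order on the line fixes
    the direction of the whole quadruple. *)
Lemma gap_pair_unique (K : R -> Prop) (q q' : pts) (x y : R) :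
  gap_pair K q -> gap_pair K q' ->
  inside (p1 q) (p2 q) x -> inside (p1 q') (p2 q') x ->
  inside (p3 q) (p4 q) y -> inside (p3 q') (p4 q') y -> q = q'.
Proof.
  intros (A & B & M) (A' & B' & M') H1 H1' H2 H2'.
  pose proof (gap_unique _ _ _ _ _ _ A A' H1 H1') as E1.
  pose proof (gap_unique _ _ _ _ _ _ B B' H2 H2') as E2.
  clear A B A' B'. unfold mono4, inside in *. destruct q as [x1 x2 x3 x4], q' as [y1 y2 y3 y4]; simpl in *.
  assert (x1 = y1 /\ x2 = y2 /\ x3 = y3 /\ x4 = y4) as (-> & -> & -> & ->); [|reflexivity].
  destruct E1 as [[]|[]]; destruct E2 as [[]|[]]; subst; lra.
Qed.

(** Serves to bound the number of objects attached to finitely many labels when the labelling is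
    injective but cannot be decided. *)
Lemma functional_list (P : nat -> R -> Prop) :
  (forall i x y, P i x -> P i y -> x = y) ->
  forall n, exists l, (length l <= n)%nat /\ forall i x, (i < n)%nat -> P i x -> In x l.
Proof.
  intros HP. induction n as [|n [l [Hl H]]].
  - exists nil. split; [simpl; lia|]. intros; lia.
  - destruct (classic (exists x, P n x)) as [[x Hx]|Hx].
    + exists (x :: l). split; [simpl; lia|]. intros i y Hi Hy.
      destruct (Nat.eq_dec i n) as [->|Hin].
      * left. eapply HP; eassumption.
      * right. apply (H i); [lia|exact Hy].
    + exists l. split; [lia|]. intros i y Hi Hy.
      destruct (Nat.eq_dec i n) as [->|Hin].
      * exfalso. apply Hx. exists y. exact Hy.
      * apply (H i); [lia|exact Hy].
Qed.

(* A gap of length at least [c] contains a point of a fixed finite grid, so the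
   number of shapes of large gap pairs is bounded independently of [K]. *)
Lemma shape_list (c : R) : 0 < c -> exists N, forall (K : R -> Prop) (r : pts -> R),
  (forall x, K x -> 0 <= x <= 1) ->
  exists l, (length l <= N)%nat /\ forall q, gap_pair K q ->
    c <= Rabs (p2 q - p1 q) -> c <= Rabs (p4 q - p3 q) -> In (r q) l.
Proof.
  intros Hc. destruct (exists_INR_gt (1 / c)) as [m [Hm Hmc]].
  assert (Hmc' : 1 < INR m * c).
  { apply Rmult_lt_compat_r with (r := c) in Hmc; [|exact Hc].
    replace (1 / c * c) with 1 in Hmc by (field; lra). exact Hmc. }
  exists ((m + 1) * (m + 1))%nat. intros K r HK.
  (* The label [e] encodes one grid point in each gap. Indices run from 0 to [m], so base [m + 1]
     makes the encoding injective. *)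
  set (P := fun e x => exists i j q, (i <= m)%nat /\ (j <= m)%nat /\ e = (i * (m + 1) + j)%nat /\
    gap_pair K q /\ inside (p1 q) (p2 q) (INR i / INR m) /\
    inside (p3 q) (p4 q) (INR j / INR m) /\ x = r q).
  destruct (functional_list P) with (n := ((m + 1) * (m + 1))%nat) as [l [Hl H]].
  { intros e x y (i & j & q & Hi & Hj & He & Hq & I1 & I2 & ->)
      (i' & j' & q' & Hi' & Hj' & He' & Hq' & I1' & I2' & ->).
    assert (i = i' /\ j = j') as [<- <-].
    { assert (i = i') by (destruct (Nat.lt_trichotomy i i') as [h|[h|h]]; [nia|exact h|nia]).
      subst i'. lia. }
    f_equal. eapply gap_pair_unique; eassumption. }
  exists l. split; [exact Hl|]. intros q Hq H1 H2.
  destruct Hq as (G1 & G2 & Hm4).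
  destruct (grid_inside m c 1 (p1 q) (p2 q)) as [i [Hi I1]]; auto; try (apply HK; apply G1).
  destruct (grid_inside m c 1 (p3 q) (p4 q)) as [j [Hj I2]]; auto; try (apply HK; apply G2).
  rewrite Rmult_1_r in Hi, Hj. apply INR_le in Hi, Hj.
  apply (H (i * (m + 1) + j)%nat); [nia|].
  exists i, j, q. repeat (split; auto).
Qed.

(** If [x + s] is too close to some entry, that entry lies in [(x, x + 2 * s)]. It is discarded and
    the search restarts at [x + 2 * s], from where every candidate is more than [s] beyond it. *)
Lemma barrier (s : R) : 0 < s -> forall n (l : list R) (x : R), (length l <= n)%nat ->
  exists t, x + s <= t <= x + (2 * INR n + 1) * s /\ forall c, In c l -> s <= Rabs (c - t).
Proof.
  intros Hs. induction n as [|n IH]; intros l x Hl.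
  - destruct l; [|simpl in Hl; lia]. exists (x + s). split; [simpl; lra|]. intros c [].
  - rewrite S_INR. pose proof (pos_INR n).
    destruct (classic (exists c, In c l /\ x < c < x + 2 * s)) as [[c [Hc Hx]]|Hn].
    + pose proof (remove_length_lt Req_EM_T l c Hc) as Hlt.
      destruct (IH (remove Req_EM_T c l) (x + 2 * s) ltac:(lia)) as [t [Ht H1]].
      exists t. split; [nra|]. intros c' Hc'.
      destruct (Req_EM_T c' c) as [->|Hne].
      * rewrite Rabs_left; lra.
      * apply H1. apply in_in_remove; assumption.
    + exists (x + s). split; [nra|]. intros c Hc.
      apply Rnot_lt_le. intro Hlt. apply Hn. exists c. apply Rabs_def2 in Hlt. split; [exact Hc|lra].
Qed.

Lemma barrier_below (s : R) (n : nat) (l : list R) (x : R) : 0 < s -> (length l <= n)%nat ->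
  exists t, x - (2 * INR n + 1) * s <= t <= x - s /\ forall c, In c l -> s <= Rabs (c - t).
Proof.
  intros Hs Hl.
  destruct (barrier s Hs n (map Ropp l) (- x)) as [t [Ht H]].
  { rewrite length_map. exact Hl. }
  exists (- t). split; [lra|]. intros c Hc.
  replace (c - - t) with (- (- c - t)) by ring. rewrite Rabs_Ropp.
  apply H. apply in_map. exact Hc.
Qed.

Lemma Rabs_bounds (x d : R) : Rabs x <= d -> - d <= x <= d.
Proof.
  pose proof (Rle_abs x). pose proof (Rle_abs (- x)) as H'. rewrite Rabs_Ropp in H'. lra.
Qed.

(* Steps shorter than the width of a centre-free window cannot cross it. *)
Lemma walk_trapped (N : nat) (C0 d : R) (u v : nat -> R) (lu lv : list R) :
  1 <= C0 -> 0 < d -> (2 * INR N + 1) * (3 * d) <= / (2 * C0) ->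
  (length lu <= N)%nat -> (length lv <= N)%nat ->
  u 0%nat <= C0 -> / C0 <= v 0%nat <= C0 ->
  (forall n, u n <= 2 * C0 -> / (2 * C0) <= v n <= 2 * C0 ->
     (exists c, In c lu /\ Rabs (u n - c) <= d) /\
     (exists c, In c lv /\ Rabs (v n - c) <= d) /\
     Rabs (u (S n) - u n) <= d /\ Rabs (v (S n) - v n) <= d) ->
  forall n, u n <= 2 * C0 /\ / (2 * C0) <= v n <= 2 * C0.
Proof.
  intros HC0 Hd HN Hlu Hlv Hu0 Hv0 Hstep.
  assert (Hi : / (2 * C0) = / C0 / 2) by (field; lra).
  assert (Hi1 : / C0 <= 1) by (rewrite <- Rinv_1; apply Rinv_le_contravar; lra).
  assert (Hi0 : 0 < / C0) by (apply Rinv_0_lt_compat; lra).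
  destruct (barrier (3 * d) ltac:(lra) N lu (u 0%nat) Hlu) as [tu [Htu Hbu]].
  destruct (barrier (3 * d) ltac:(lra) N lv (v 0%nat) Hlv) as [tv [Htv Hbv]].
  destruct (barrier_below (3 * d) N lv (v 0%nat) ltac:(lra) Hlv) as [tw [Htw Hbw]].
  (* A value within [d] of a centre, with the centre [3 * d] away from the barrier, is [2 * d] away
     from the barrier, and a step covers only [d]. *)
  assert (Hfar : forall l t x, (forall c, In c l -> 3 * d <= Rabs (c - t)) ->
    (exists c, In c l /\ Rabs (x - c) <= d) -> 2 * d <= Rabs (x - t)).
  { intros l t x Hb [c [Hc Hxc]]. specialize (Hb c Hc).
    pose proof (Rabs_triang (c - x) (x - t)) as Htr.
    replace (c - x + (x - t)) with (c - t) in Htr by ring.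
    rewrite (Rabs_minus_sym c x) in Htr. lra. }
  (* Each barrier is at most [/ (2 * C0)] from the corresponding starting value, so staying between
     barriers implies the window in which [Hstep] may be used. *)
  assert (H : forall n, u n < tu /\ tw < v n < tv).
  { induction n as [|n [IHu IHv]]; [lra|].
    destruct (Hstep n) as (A & B & D & E); [lra|lra|].
    apply (Hfar _ _ _ Hbu) in A.
    assert (B' := Hfar _ _ _ Hbv B). apply (Hfar _ _ _ Hbw) in B.
    rewrite Rabs_left in A by lra. rewrite Rabs_left in B' by lra. rewrite Rabs_right in B by lra.
    apply Rabs_bounds in D. apply Rabs_bounds in E. lra. }
  intros n. specialize (H n). lra.
Qed.

(** * Minimal sets of circle diffeomorphisms *)

Lemma frac_part_shift (x : R) : exists m, x = frac_part x + IZR m.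
Proof. exists (Int_part x). unfold frac_part. ring. Qed.

Lemma frac_part_bounds (x : R) : 0 <= frac_part x < 1.
Proof. destruct (base_fp x). lra. Qed.

Lemma frac_part_IZR (x : R) (m : Z) : frac_part (x + IZR m) = frac_part x.
Proof.
  unfold frac_part. rewrite <- (Int_part_spec (x + IZR m) (Int_part x + m)).
  - rewrite plus_IZR. ring.
  - destruct (base_Int_part x). rewrite plus_IZR. lra.
Qed.

Lemma frac_part_id (x : R) : 0 <= x < 1 -> frac_part x = x.
Proof. intros H. unfold frac_part. rewrite <- (Int_part_spec x 0); simpl; lra. Qed.

Lemma frac_part_eq (x y : R) : frac_part x = frac_part y -> exists m, x = y + IZR m.
Proof.
  intros H. exists (Int_part x - Int_part y)%Z. unfold frac_part in H.
  rewrite minus_IZR. lra.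
Qed.

Definition lift (K : R -> Prop) (x : R) : Prop := K (frac_part x).

Lemma lift_IZR (K : R -> Prop) (x : R) (m : Z) : lift K (x + IZR m) <-> lift K x.
Proof. unfold lift. rewrite frac_part_IZR. tauto. Qed.

Lemma gap_lift_IZR (K : R -> Prop) (p q : R) (m : Z) :
  gap (lift K) p q -> gap (lift K) (p + IZR m) (q + IZR m).
Proof.
  intros (A & B & N & H). split; [apply lift_IZR; exact A|]. split; [apply lift_IZR; exact B|].
  split; [lra|]. intros x Hx.
  assert (Hx' : lift K (x + IZR (- m))) by (apply lift_IZR; exact Hx).
  destruct (H _ Hx') as [H1 H2]. rewrite opp_IZR in H1, H2. lra.
Qed.

Lemma gap_lift_le_1 (K : R -> Prop) (p q : R) : gap (lift K) p q -> Rabs (q - p) <= 1.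
Proof.
  intros (A & B & N & H).
  destruct (H (p + IZR 1)) as [H1 _]; [apply lift_IZR; exact A|].
  destruct (H (p + IZR (-1))) as [_ H2]; [apply lift_IZR; exact A|].
  simpl in *. apply Rabs_le. lra.
Qed.

Lemma avoid_list (K : R -> Prop) (O : list R) (x e : R) :
  (forall x e, K x -> 0 < e -> exists y, K y /\ y <> x /\ Rabs (y - x) < e) ->
  K x -> 0 < e -> exists y, K y /\ Rabs (y - x) < e /\ ~ In y O.
Proof.
  intros Hp Kx He.
  assert (H : exists d, 0 < d <= e /\ forall o, In o O -> o <> x -> d <= Rabs (o - x)).
  { induction O as [|o O [d [Hd H]]].
    - exists e. split; [lra|]. intros o [].
    - destruct (Req_dec o x) as [->|Hne].
      + exists d. split; [exact Hd|]. intros o' [<-|Ho'] N; [tauto|auto].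
      + assert (0 < Rabs (o - x)) by (apply Rabs_pos_lt; lra).
        exists (Rmin d (Rabs (o - x))).
        pose proof (Rmin_l d (Rabs (o - x))). pose proof (Rmin_r d (Rabs (o - x))).
        split; [split; [apply Rmin_pos; lra|lra]|].
        intros o' [<-|Ho'] N; [lra|]. specialize (H o' Ho' N). lra. }
  destruct H as [d [Hd H]]. destruct (Hp x d Kx ltac:(lra)) as [y [Ky [Ny Hy]]].
  exists y. split; [exact Ky|]. split; [lra|]. intros Hin. specialize (H y Hin Ny). lra.
Qed.

Lemma far_list (O : list R) (y : R) : 0 <= y < 1 -> ~ In y O ->
  exists e, 0 < e /\ forall o, In o O -> 0 <= o < 1 -> ~ circ_close o y e.
Proof.
  intros Hy. induction O as [|o O IH]; intros Hn.
  - exists 1. split; [lra|]. intros o [].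
  - destruct IH as [e [He H]]; [intro; apply Hn; right; assumption|].
    destruct (classic (0 <= o < 1)) as [Ho|Ho].
    + assert (Hne : o <> y) by (intros ->; apply Hn; left; reflexivity).
      set (d := Rabs (o - y)).
      assert (Hd : 0 < d) by (apply Rabs_pos_lt; lra).
      assert (Hd1 : d < 1) by (apply Rabs_def1; lra).
      (* For representatives in [[0, 1)] at distance [d] on the line, the distance on the circle is
         the smaller of [d] and [1 - d]. *)
      exists (Rmin e (Rmin d (1 - d))).
      pose proof (Rmin_l e (Rmin d (1 - d))). pose proof (Rmin_r e (Rmin d (1 - d))).
      pose proof (Rmin_l d (1 - d)). pose proof (Rmin_r d (1 - d)).
      split; [repeat apply Rmin_pos; lra|].
      intros o' [<-|Ho'] Hb.
      * intros [m Hm].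
        destruct (Z.eq_dec m 0) as [->|Hm0].
        { rewrite Rminus_0_r in Hm. fold d in Hm. lra. }
        assert (1 <= Rabs (IZR m)).
        { rewrite <- abs_IZR. apply IZR_le. lia. }
        pose proof (Rabs_triang (o - y) (- (o - y - IZR m))) as Htr.
        replace (o - y + - (o - y - IZR m)) with (IZR m) in Htr by ring.
        rewrite Rabs_Ropp in Htr. fold d in Htr. lra.
      * intros [m Hm]. apply (H o' Ho' Hb). exists m. lra.
    + exists e. split; [exact He|]. intros o' [<-|Ho'] Hb; [tauto|]. apply H; auto.
Qed.

Lemma pigeonhole (P : nat -> nat -> Prop) (n : nat) :
  (forall N, exists m, (N <= m)%nat /\ exists i, (i < n)%nat /\ P i m) ->
  exists i, forall N, exists m, (N <= m)%nat /\ P i m.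
Proof.
  induction n as [|n IH]; intros H.
  - destruct (H 0%nat) as [m [_ [i [Hi _]]]]. lia.
  - destruct (classic (forall N, exists m, (N <= m)%nat /\ P n m)) as [Hn|Hn]; [exists n; exact Hn|].
    apply not_all_ex_not in Hn. destruct Hn as [N0 HN0].
    apply IH. intros N. destruct (H (N + N0)%nat) as [m [Hm [i [Hi Pi]]]].
    exists m. split; [lia|]. exists i. split; [|exact Pi].
    destruct (Nat.eq_dec i n) as [->|]; [|lia].
    exfalso. apply HN0. exists m. split; [lia|exact Pi].
Qed.

Section CircleMap.
Variables (F dF : R -> R).
Hypothesis HF : circle_C1_diffeo_lift F dF.

Lemma lift_continuous : continuity F.
Proof.
  intros x. apply derivable_continuous_pt. exists (dF x). apply HF.
Qed.

Lemma lift_shift : exists e : Z, (e = 1 \/ e = -1)%Z /\ forall x m, F (x + IZR m) = F x + IZR (e * m).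
Proof.
  destruct HF as (_ & _ & _ & d & Hd & Hs).
  assert (Hn : forall n x, F (x + INR n) = F x + d * INR n).
  { induction n as [|n IH]; intros x; [simpl; rewrite Rmult_0_r, !Rplus_0_r; reflexivity|].
    rewrite S_INR, <- Rplus_assoc, Hs, IH. ring. }
  assert (Hz : forall m x, F (x + IZR m) = F x + d * IZR m).
  { intros m x. destruct (Z_le_dec 0 m) as [Hm|Hm].
    - rewrite <- (Z2Nat.id m Hm), <- INR_IZR_INZ. apply Hn.
    - pose proof (Hn (Z.to_nat (- m)) (x + IZR m)) as E.
      rewrite INR_IZR_INZ, Z2Nat.id, opp_IZR in E by lia.
      replace (x + IZR m + - IZR m) with x in E by ring. lra. }
  destruct Hd as [-> | ->].
  - exists 1%Z. split; [auto|]. intros x m. rewrite Hz, mult_IZR. reflexivity.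
  - exists (-1)%Z. split; [auto|]. intros x m. rewrite Hz, mult_IZR. reflexivity.
Qed.

Lemma iter_shift (n : nat) (m : Z) :
  exists m' : Z, forall x, Nat.iter n F (x + IZR m) = Nat.iter n F x + IZR m'.
Proof.
  destruct lift_shift as [e [_ He]]. induction n as [|n [m' IH]].
  - exists m. reflexivity.
  - exists (e * m')%Z. intros x. simpl. rewrite IH. apply He.
Qed.

Lemma lift_mono : (forall x y, x < y -> F x < F y) \/ (forall x y, x < y -> F y < F x).
Proof.
  destruct HF as (Hd & Hc & Hnz & _).
  assert (Hs : forall x y, x <= y -> 0 < dF x * dF y).
  { intros x y Hxy. apply Rnot_le_lt. intro Hle.
    destruct (IVT_cor dF x y Hc Hxy Hle) as [z [_ Hz]]. exact (Hnz z Hz). }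
  assert (Hs' : forall x y, 0 < dF x * dF y).
  { intros x y. destruct (Rle_dec x y); [auto|]. rewrite Rmult_comm. apply Hs. lra. }
  assert (Hm : forall x y, x < y -> exists z, F y - F x = dF z * (y - x)).
  { intros x y Hxy. destruct (MVT_cor2 F dF x y Hxy) as [z [Hz _]]; [auto|]. exists z. exact Hz. }
  destruct (Rdichotomy _ _ (Hnz 0)) as [H0|H0].
  - right. intros x y Hxy. destruct (Hm x y Hxy) as [z Hz]. specialize (Hs' 0 z). nra.
  - left. intros x y Hxy. destruct (Hm x y Hxy) as [z Hz]. specialize (Hs' 0 z). nra.
Qed.

Lemma iter_mono (n : nat) : (forall x y, x < y -> Nat.iter n F x < Nat.iter n F y) \/
  (forall x y, x < y -> Nat.iter n F y < Nat.iter n F x).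
Proof.
  induction n as [|n IH]; [left; auto|].
  destruct lift_mono as [H|H]; destruct IH as [IH|IH]; simpl; auto.
Qed.

Lemma iter_continuous (n : nat) : continuity (Nat.iter n F).
Proof.
  induction n as [|n IH].
  - intros x. apply derivable_continuous_pt, derivable_pt_id.
  - intros x. apply (continuity_pt_comp (Nat.iter n F) F); [apply IH|apply lift_continuous].
Qed.

Lemma iter_inj (n : nat) (x y : R) : Nat.iter n F x = Nat.iter n F y -> x = y.
Proof.
  intros E. destruct (Rtotal_order x y) as [H|[H|H]]; [|exact H|];
    destruct (iter_mono n) as [Hm|Hm]; specialize (Hm _ _ H); lra.
Qed.

Lemma iter_contained (n : nat) (lo hi x y : R) : lo <= x <= hi -> lo <= y <= hi ->
  Rabs (Nat.iter n F x - Nat.iter n F y) <= Rabs (Nat.iter n F hi - Nat.iter n F lo).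
Proof.
  intros Hx Hy.
  destruct (iter_mono n) as [Hm|Hm].
  - assert (W : forall u v, u <= v -> Nat.iter n F u <= Nat.iter n F v).
    { intros u v [H| ->]; [left; auto|lra]. }
    pose proof (W lo x ltac:(lra)). pose proof (W x hi ltac:(lra)).
    pose proof (W lo y ltac:(lra)). pose proof (W y hi ltac:(lra)).
    rewrite (Rabs_right (Nat.iter n F hi - _)) by lra. apply Rabs_le. lra.
  - assert (W : forall u v, u <= v -> Nat.iter n F v <= Nat.iter n F u).
    { intros u v [H| ->]; [left; auto|lra]. }
    pose proof (W lo x ltac:(lra)). pose proof (W x hi ltac:(lra)).
    pose proof (W lo y ltac:(lra)). pose proof (W y hi ltac:(lra)).
    rewrite (Rabs_left1 (Nat.iter n F hi - _)) by lra. apply Rabs_le. lra.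
Qed.

Lemma iter_frac_inj (n : nat) (x y : R) :
  frac_part (Nat.iter n F x) = frac_part (Nat.iter n F y) -> frac_part x = frac_part y.
Proof.
  revert x y. induction n as [|n IH]; intros x y E; [exact E|]. simpl in E.
  apply IH. apply frac_part_eq in E. destruct E as [m E].
  destruct lift_shift as [e [He Hs]].
  (* The degree [e] is its own inverse, so translating by [e * m] before [F] gives translation by
     [m] after it. *)
  assert (E' : F (Nat.iter n F x) = F (Nat.iter n F y + IZR (e * m))).
  { rewrite Hs, E. f_equal. f_equal. destruct He as [-> | ->]; lia. }
  apply (iter_inj 1) in E'. rewrite E'. apply frac_part_IZR.
Qed.

Lemma dF_periodic (x : R) (m : Z) : dF (x + IZR m) = dF x.
Proof.
  destruct HF as (Hd & _). destruct lift_shift as [e [_ Hs]].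
  apply (uniqueness_limite F x); [|apply Hd].
  intros eps He. destruct (Hd (x + IZR m) eps He) as [del H]. exists del.
  intros h Hh Hhd. specialize (H h Hh Hhd).
  replace (x + IZR m + h) with (x + h + IZR m) in H by ring.
  rewrite !Hs in H. replace (F (x + h) - F x) with
    (F (x + h) + IZR (e * m) - (F x + IZR (e * m))) by ring. exact H.
Qed.

(** By periodicity [Rabs (dF x)] has a positive minimum and [dF] is uniformly continuous, so on
    short intervals the ratio of derivatives is near 1, uniformly in position. *)
Lemma lift_distortion (f : R) : 1 < f -> exists r, 0 < r /\
  forall s t x y u v, t - s < r -> s <= x <= t -> s <= y <= t -> s <= u <= t -> s <= v <= t ->
    Rabs (F y - F x) * Rabs (v - u) <= f * (Rabs (F v - F u) * Rabs (y - x)).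
Proof.
  intros Hf. destruct HF as (Hd & Hc & Hnz & _).
  assert (Hca : forall x, continuity_pt (fun x => Rabs (dF x)) x).
  { intros x. apply (continuity_pt_comp dF Rabs); [apply Hc|apply Rcontinuity_abs]. }
  destruct (continuity_ab_min (fun x => Rabs (dF x)) 0 1) as [z [Hz _]]; [lra|auto|].
  set (m0 := Rabs (dF z)) in *.
  assert (Hm0 : 0 < m0) by (apply Rabs_pos_lt, Hnz).
  assert (Hmin : forall x, m0 <= Rabs (dF x)).
  { intros x. destruct (frac_part_shift x) as [m ->]. rewrite dF_periodic.
    apply Hz. pose proof (frac_part_bounds x). lra. }
  assert (He : 0 < (f - 1) * m0) by nra.
  (* After translating [y] into [[0, 1)], a point within 1 of it lies in [[-1, 2]]; hence the cap by
     1 on the radius. *)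
  destruct (@Heine_cor2 dF (-1) 2 (fun x _ => Hc x) (mkposreal _ He)) as [del Hdel]. simpl in Hdel.
  exists (Rmin del 1). split; [apply Rmin_pos; [apply cond_pos|lra]|].
  pose proof (Rmin_l del 1). pose proof (Rmin_r del 1).
  assert (Hclose : forall x y, Rabs (x - y) < Rmin del 1 -> Rabs (dF x) <= f * Rabs (dF y)).
  { intros x y Hxy. destruct (frac_part_shift y) as [m Hy].
    pose proof (frac_part_bounds y) as Hb.
    assert (Hxy' := Rabs_def2 _ _ Hxy).
    specialize (Hdel (x + IZR (- m)) (y + IZR (- m))).
    rewrite !dF_periodic in Hdel.
    assert (Hlt : Rabs (dF x - dF y) < (f - 1) * m0).
    { rewrite opp_IZR in Hdel. apply Hdel; [lra|lra|].
      replace (x + - IZR m - (y + - IZR m)) with (x - y) by ring. lra. }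
    pose proof (Rabs_triang_inv (dF x) (dF y)). specialize (Hmin y). nra. }
  intros s t x y u v Hst Hx Hy Hu Hv.
  destruct (Req_dec x y) as [->|Hxy].
  { rewrite !Rminus_diag, Rabs_R0. lra. }
  destruct (Req_dec u v) as [->|Huv].
  { rewrite !Rminus_diag, Rabs_R0. lra. }
  assert (Hm : forall x y, s <= x <= t -> s <= y <= t -> x <> y ->
    exists z, s <= z <= t /\ Rabs (F y - F x) = Rabs (dF z) * Rabs (y - x)).
  { clear x y u v Hx Hy Hu Hv Hxy Huv. intros x y Hx Hy Hxy.
    destruct (Rlt_dec x y).
    - destruct (MVT_cor2 F dF x y r) as [w [Hw1 Hw2]]; [auto|].
      exists w. split; [lra|]. rewrite Hw1. apply Rabs_mult.
    - destruct (MVT_cor2 F dF y x ltac:(lra)) as [w [Hw1 Hw2]]; [auto|].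
      exists w. split; [lra|]. rewrite (Rabs_minus_sym (F y)), Hw1, Rabs_mult, (Rabs_minus_sym x).
      reflexivity. }
  destruct (Hm x y Hx Hy Hxy) as [w [Hw ->]]. destruct (Hm u v Hu Hv Huv) as [w' [Hw' ->]].
  assert (Hcl : Rabs (dF w) <= f * Rabs (dF w')).
  { apply Hclose. apply Rle_lt_trans with (t - s); [apply Rabs_le; lra|exact Hst]. }
  assert (0 <= Rabs (y - x) * Rabs (v - u)) by (apply Rmult_le_pos; apply Rabs_pos).
  nra.
Qed.

(** * Gaps and contracting intervals of a minimal set *)

Variable K : R -> Prop.
Hypothesis HK : minimal_set F K.
Hypothesis Hperf :
  forall x e, K x -> 0 < e -> exists y, K y /\ y <> x /\ Rabs (y - x) < e.

Lemma K_unit (x : R) : K x -> 0 <= x < 1.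
Proof. apply HK. Qed.

Lemma lift_of_K (x : R) : K x -> lift K x.
Proof. intros Hx. unfold lift. rewrite frac_part_id; [exact Hx|apply K_unit, Hx]. Qed.

Lemma lift_F (x : R) : lift K x <-> lift K (F x).
Proof.
  destruct HK as (_ & _ & _ & Hinv & Hsur & _). destruct lift_shift as [e [He Hs]].
  assert (E : frac_part (F x) = frac_part (F (frac_part x))).
  { destruct (frac_part_shift x) as [m Hm]. rewrite Hm at 1. rewrite Hs. apply frac_part_IZR. }
  unfold lift. rewrite E. split; [apply Hinv|].
  intros H. destruct (Hsur _ H) as [z [Kz Ez]].
  apply (iter_frac_inj 1) in Ez.
  rewrite (frac_part_id z (K_unit z Kz)), (frac_part_id _ (frac_part_bounds x)) in Ez.
  rewrite Ez. exact Kz.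
Qed.

Lemma lift_iter (n : nat) (x : R) : lift K x -> lift K (Nat.iter n F x).
Proof. intros H. induction n as [|n IH]; [exact H|]. apply (lift_F (Nat.iter n F x)), IH. Qed.

Lemma lift_closed (x : R) :
  (forall e, 0 < e -> exists y, lift K y /\ Rabs (x - y) < e) -> lift K x.
Proof.
  intros H. destruct HK as (_ & _ & Hcl & _).
  apply Hcl; [apply frac_part_bounds|]. intros e He.
  destruct (H e He) as [y [Ky Hy]]. exists (frac_part y). split; [exact Ky|].
  exists (Int_part y - Int_part x)%Z. unfold frac_part. rewrite minus_IZR.
  replace (_ - _ - _) with (x - y) by ring. exact Hy.
Qed.

Lemma gap_F (p q : R) : gap (lift K) p q -> gap (lift K) (F p) (F q).
Proof.
  intros (A & B & N & H).
  split; [apply -> lift_F; exact A|]. split; [apply -> lift_F; exact B|].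
  split; [intro E; apply (iter_inj 1) in E; auto|].
  assert (Hpre : forall x u v, u <= v -> F u < x < F v \/ F v < x < F u ->
    exists z, u <= z <= v /\ F z = x).
  { intros x u v Huv Hx.
    destruct (IVT_cor (fun t => F t - x) u v) as [z [Hz1 Hz2]]; [|exact Huv|nra|].
    - intros t. apply continuity_pt_minus; [apply lift_continuous|].
      apply continuity_pt_const. intros ? ?; reflexivity.
    - exists z. split; [exact Hz1|lra]. }
  assert (Hcase : forall x, lift K x -> F p < x < F q \/ F q < x < F p -> False).
  { intros x Hx Hb.
    assert (exists z, F z = x /\ (p < z < q \/ q < z < p)) as [z [<- Hz]].
    { destruct (Rlt_dec p q).
      - destruct (Hpre x p q ltac:(lra) Hb) as [z [Hz <-]]. exists z. split; [reflexivity|].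
        left. destruct Hz as [[Hz|<-] [Hz'|<-]]; lra.
      - destruct (Hpre x q p ltac:(lra) ltac:(tauto)) as [z [Hz <-]]. exists z. split; [reflexivity|].
        right. destruct Hz as [[Hz|<-] [Hz'|<-]]; lra. }
    apply lift_F in Hx. destruct (H z Hx). tauto. }
  intros x Hx. split; intro Hb; apply (Hcase x Hx); auto.
Qed.

Lemma gap_iter (n : nat) (p q : R) : gap (lift K) p q ->
  gap (lift K) (Nat.iter n F p) (Nat.iter n F q).
Proof. intros H. induction n as [|n IH]; [exact H|]. apply gap_F, IH. Qed.

Lemma no_periodic_point (x : R) (n : nat) (m : Z) : lift K x -> (0 < n)%nat ->
  Nat.iter n F x <> x + IZR m.
Proof.
  intros Hx Hn E.
  set (y := frac_part x).
  assert (Hy : 0 <= y < 1) by apply frac_part_bounds.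
  assert (Ey : frac_part (Nat.iter n F y) = frac_part y).
  { destruct (frac_part_shift x) as [c Hc]. fold y in Hc.
    destruct (iter_shift n c) as [c' Hc']. specialize (Hc' y). rewrite <- Hc, E, Hc in Hc'.
    rewrite <- (frac_part_IZR (Nat.iter n F y) c'), <- Hc', !frac_part_IZR. reflexivity. }
  assert (Hper : forall i, frac_part (Nat.iter (i + n) F y) = frac_part (Nat.iter i F y)).
  { intros i. rewrite Nat.iter_add. apply frac_part_eq in Ey. destruct Ey as [c Hc]. rewrite Hc.
    destruct (iter_shift i c) as [c' ->]. apply frac_part_IZR. }
  set (O := map (fun i => frac_part (Nat.iter i F y)) (seq 0 n)).
  assert (HO : forall i, In (frac_part (Nat.iter i F y)) O).
  { intros i. induction i as [i IH] using (well_founded_induction lt_wf).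
    destruct (Nat.lt_ge_cases i n) as [Hi|Hi].
    - unfold O. apply (in_map (fun i => frac_part (Nat.iter i F y))). apply in_seq. lia.
    - replace i with (i - n + n)%nat by lia. rewrite Hper. apply IH. lia. }
  assert (Hmul : forall j, frac_part (Nat.iter (j * n) F y) = frac_part y).
  { induction j as [|j IH]; [reflexivity|].
    replace (Datatypes.S j * n)%nat with (j * n + n)%nat by lia. rewrite Hper. exact IH. }
  (* Full orbits include backward iterates. If [z] reaches [y] in [j] steps, so does the forward
     iterate of [y] of order [j * (n - 1)], and injectivity on the circle identifies the two. *)
  assert (Horb : forall z, in_orbit F y z -> In z O).
  { intros z [Hz [j [-> | Ej]]]; [apply HO|].
    rewrite <- (frac_part_id z Hz).
    replace (frac_part z) with (frac_part (Nat.iter (j * (n - 1)) F y)); [apply HO|].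
    apply (iter_frac_inj j). rewrite <- Nat.iter_add.
    replace (j + j * (n - 1))%nat with (j * n)%nat by nia.
    rewrite Hmul, <- Ej. apply frac_part_id, Hy. }
  destruct (avoid_list K O y 1 Hperf Hx ltac:(lra)) as [w [Kw [_ Hw]]].
  destruct (far_list O w (K_unit w Kw) Hw) as [e [He Hfar]].
  destruct HK as (_ & _ & _ & _ & _ & Hdense).
  destruct (Hdense y w Hx Kw e He) as [z [Hz Hzw]].
  apply (Hfar z); [apply Horb, Hz|apply Hz|exact Hzw].
Qed.

(** Infinitely many iterates of length at least [r] would meet a finite grid, after integer
    translation, so two of them would contain the same grid point. Two such gaps coincide, and their
    common end is periodic on the circle. *)
Lemma gap_shrink (p q r : R) : gap (lift K) p q -> 0 < r ->
  exists N, forall n, (N <= n)%nat -> Rabs (Nat.iter n F q - Nat.iter n F p) < r.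
Proof.
  intros Hpq Hr. apply NNPP. intro Hnot.
  assert (Hinf : forall N, exists n, (N <= n)%nat /\ r <= Rabs (Nat.iter n F q - Nat.iter n F p)).
  { intros N. apply NNPP. intro Hn. apply Hnot. exists N. intros n HNn.
    apply Rnot_le_lt. intro Hle. apply Hn. exists n. auto. }
  destruct (exists_INR_gt (1 / r)) as [m [Hm Hmr]].
  assert (Hmr' : 1 < INR m * r).
  { apply Rmult_lt_compat_r with (r := r) in Hmr; [|exact Hr].
    replace (1 / r * r) with 1 in Hmr by (field; lra). exact Hmr. }
  set (P := fun i n => exists c : Z,
    inside (Nat.iter n F p + IZR c) (Nat.iter n F q + IZR c) (INR i / INR m)).
  destruct (pigeonhole P (m * 3 + 1)) as [i Hi].
  { intros N. destruct (Hinf N) as [n [HNn Hn]]. exists n. split; [exact HNn|].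
    destruct (frac_part_shift (Nat.iter n F p)) as [c Hc].
    pose proof (frac_part_bounds (Nat.iter n F p)) as Hb.
    set (y := frac_part (Nat.iter n F p)) in *.
    pose proof (gap_lift_le_1 K _ _ (gap_iter n p q Hpq)) as H1.
    apply Rabs_bounds in H1.
    (* The translation puts the first end into [[1, 2)]; gaps have length at most 1, so the other
       end lies in [[0, 3]]. *)
    destruct (grid_inside m r 3 (Nat.iter n F p + IZR (1 - c)) (Nat.iter n F q + IZR (1 - c)))
      as [i [Hi Hin]]; auto; try (rewrite minus_IZR; lra).
    { replace (_ - _) with (Nat.iter n F q - Nat.iter n F p) by ring. exact Hn. }
    exists i. split.
    - assert (i <= m * 3)%nat; [|lia]. apply INR_le. rewrite mult_INR. simpl INR in *. lra.
    - exists (1 - c)%Z. exact Hin. }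
  destruct (Hi 0%nat) as [n [_ [c Hc]]].
  destruct (Hi (Datatypes.S n)) as [n' [Hn' [c' Hc']]].
  set (D := (n' - n)%nat).
  assert (HD : forall x, Nat.iter n' F x = Nat.iter D F (Nat.iter n F x)).
  { intros x. rewrite <- Nat.iter_add. f_equal. unfold D. lia. }
  pose proof (gap_lift_IZR K _ _ c (gap_iter n p q Hpq)) as G.
  pose proof (gap_lift_IZR K _ _ c' (gap_iter n' p q Hpq)) as G'.
  assert (Kp : lift K (Nat.iter n F p)) by (apply lift_iter, Hpq).
  destruct (gap_unique _ _ _ _ _ _ G G' Hc Hc') as [[E1 E2]|[E1 E2]]; rewrite !HD in *.
  - apply (no_periodic_point (Nat.iter n F p) D (c - c')); [exact Kp|unfold D; lia|].
    rewrite minus_IZR. lra.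
  (* The gap returns reversed: the iterate of order [D] swaps its ends up to integers, so twice that
     order fixes them up to integers. *)
  - set (u := Nat.iter n F p) in *. set (v := Nat.iter n F q) in *.
    destruct (iter_shift D (c - c')) as [d Hd].
    apply (no_periodic_point u (D + D) (c - c' + d)); [exact Kp|unfold D; lia|].
    rewrite Nat.iter_add.
    assert (Eu : Nat.iter D F u = v + IZR (c - c')) by (rewrite minus_IZR; lra).
    rewrite Eu, Hd, plus_IZR, minus_IZR. lra.
Qed.

Lemma orbit_list (x : R) (N : nat) : exists O, forall n z, (n <= N)%nat -> 0 <= z < 1 ->
  z = frac_part (Nat.iter n F x) \/ x = frac_part (Nat.iter n F z) -> In z O.
Proof.
  destruct (functional_list (fun n z => z = frac_part (Nat.iter n F x)))
    with (n := Datatypes.S N) as [l1 [_ H1]].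
  { intros i y z -> ->. reflexivity. }
  destruct (functional_list (fun n z => 0 <= z < 1 /\ x = frac_part (Nat.iter n F z)))
    with (n := Datatypes.S N) as [l2 [_ H2]].
  { intros i y z [Hy Ey] [Hz Ez].
    rewrite <- (frac_part_id y Hy), <- (frac_part_id z Hz).
    apply (iter_frac_inj i). congruence. }
  exists (l1 ++ l2). intros n z Hn Hz H. apply in_or_app.
  destruct H as [H|H].
  - left. apply (H1 n); [lia|exact H].
  - right. apply (H2 n); [lia|split; assumption].
Qed.

(** The fixed point found by the intermediate value theorem need not visibly lie in [K]. But
    iterates of [x] come arbitrarily near its orbit, as the images of the interval shrink, and
    closedness then puts it into [K]. *)
Lemma self_map_absurd (lo hi x : R) (n : nat) (m : Z) : lo <= x <= hi -> lift K x ->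
  (0 < n)%nat -> (forall w, lo <= w <= hi -> lo <= Nat.iter n F w + IZR m <= hi) ->
  (forall r, 0 < r -> exists N, forall n, (N <= n)%nat ->
     Rabs (Nat.iter n F hi - Nat.iter n F lo) < r) -> False.
Proof.
  intros Hx Kx Hn Hself Hsh.
  destruct (IVT_cor (fun w => Nat.iter n F w + IZR m - w) lo hi) as [f [Hf Ef]].
  - intros t. apply continuity_pt_minus; [apply continuity_pt_plus|].
    + apply iter_continuous.
    + apply continuity_pt_const. intros ? ?; reflexivity.
    + apply derivable_continuous_pt, derivable_pt_id.
  - lra.
  - pose proof (Hself lo ltac:(lra)). pose proof (Hself hi ltac:(lra)). nra.
  - assert (Hj : forall j, exists c : Z, Nat.iter (j * n) F f + IZR c = f).
    { induction j as [|j [c IH]].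
      - exists 0%Z. simpl. ring.
      - destruct (iter_shift n (- c)) as [c' Hc'].
        exists (m - c')%Z. replace (Datatypes.S j * n)%nat with (n + j * n)%nat by lia.
        rewrite Nat.iter_add.
        replace (Nat.iter (j * n) F f) with (f + IZR (- c)) by (rewrite opp_IZR; lra).
        rewrite Hc', minus_IZR. lra. }
    apply (no_periodic_point f n (- m)); [|exact Hn|rewrite opp_IZR; lra].
    apply lift_closed. intros e He. destruct (Hsh e He) as [N HN].
    destruct (Hj N) as [c Hc]. exists (Nat.iter (N * n) F x + IZR c). split.
    + apply lift_IZR, lift_iter, Kx.
    + replace (f - _) with (Nat.iter (N * n) F f - Nat.iter (N * n) F x) by lra.
      eapply Rle_lt_trans; [apply (iter_contained _ lo hi); lra|]. apply HN. nia.
Qed.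

Lemma contracting_interval_absurd (lo x hi : R) : K x -> lo < x < hi ->
  (forall r, 0 < r -> exists N, forall n, (N <= n)%nat ->
     Rabs (Nat.iter n F hi - Nat.iter n F lo) < r) -> False.
Proof.
  intros Kx Hx Hsh.
  set (r := Rmin (x - lo) (hi - x) / 3).
  assert (Hr : 0 < r) by (apply Rdiv_lt_0_compat; [apply Rmin_pos; lra|lra]).
  assert (Hr' : lo <= x - 3 * r /\ x + 3 * r <= hi).
  { pose proof (Rmin_l (x - lo) (hi - x)). pose proof (Rmin_r (x - lo) (hi - x)).
    unfold r. lra. }
  destruct (Hsh r Hr) as [N HN].
  destruct (orbit_list x N) as [O HO].
  (* The target [y] avoids everything reached from [x] within [N] steps in either direction, so an
     orbit point close enough to [y] needs more than [N] steps. *)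
  destruct (avoid_list K O x r Hperf Kx Hr) as [y [Ky [Hy Hyo]]].
  destruct (far_list O y (K_unit y Ky) Hyo) as [e [He Hfar]].
  destruct HK as (_ & _ & _ & _ & _ & Hdense).
  destruct (Hdense x y Kx Ky (Rmin e r) ltac:(apply Rmin_pos; lra)) as [z [[Hz [n Hn]] [m Hzy]]].
  pose proof (Rmin_l e r). pose proof (Rmin_r e r).
  assert (HNn : (N < n)%nat).
  { apply Nat.nle_gt. intro Hle. apply (Hfar z); [apply (HO n); auto|exact Hz|].
    exists m. lra. }
  apply Rabs_def2 in Hy. apply Rabs_def2 in Hzy.
  specialize (HN n ltac:(lia)).
  assert (exists c, forall w, lo <= w <= hi -> lo <= Nat.iter n F w + IZR c <= hi) as [c Hc].
  (* In either direction some point of the interval is sent, modulo integers, well inside the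
     interval: [x] lands near [y], or a point near [y] lands on [x]. The image is shorter than [r],
     so it stays inside. *)
  { destruct Hn as [Hn|Hn].
    - exists (- m - Int_part (Nat.iter n F x))%Z. intros w Hw.
      pose proof (iter_contained n lo hi w x Hw ltac:(lra)) as Hcon.
      assert (Hd : Rabs (Nat.iter n F w - Nat.iter n F x) < r) by lra.
      apply Rabs_def2 in Hd. unfold frac_part in Hn. rewrite minus_IZR, opp_IZR. lra.
    - destruct (iter_shift n (- m)) as [c Hc].
      exists (- c - Int_part (Nat.iter n F z))%Z. intros w Hw.
      assert (Hz' : lo <= z + IZR (- m) <= hi) by (rewrite opp_IZR; lra).
      pose proof (iter_contained n lo hi w _ Hw Hz') as Hcon. rewrite Hc in Hcon.
      assert (Hd : Rabs (Nat.iter n F w - (Nat.iter n F z + IZR c)) < r) by lra.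
      apply Rabs_def2 in Hd. unfold frac_part in Hn. rewrite minus_IZR, opp_IZR. lra. }
  apply (self_map_absurd lo hi x n c); auto; [lra|apply lift_of_K, Kx|lia].
Qed.

End CircleMap.

(** * Trapping the shape along the orbit *)

Lemma cmp_close (f ka B u v : R) : f <= 1 + ka -> 0 <= ka <= 1 -> 0 <= u <= B -> 0 <= v ->
  cmp f u v -> v <= 2 * B /\ Rabs (u - v) <= ka * (2 * B) /\ u <= 2 * v.
Proof.
  intros Hf Hka Hu Hv [A1 A2].
  assert (A1' : u <= (1 + ka) * v) by nra. assert (A2' : v <= (1 + ka) * u) by nra.
  assert (Hv' : v <= 2 * B) by nra.
  split; [exact Hv'|]. split; [apply Rabs_le; nra|nra].
Qed.

Lemma gap_lift (K : R -> Prop) (p q : R) : (forall x, K x -> 0 <= x < 1) ->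
  gap K p q -> gap (lift K) p q.
Proof.
  intros HK (A & B & N & H). pose proof (HK p A). pose proof (HK q B).
  unfold lift. split; [rewrite frac_part_id; assumption|].
  split; [rewrite frac_part_id; assumption|]. split; [exact N|].
  intros x Hx. split; intro Hb; rewrite frac_part_id in Hx by lra; destruct (H x Hx); tauto.
Qed.

Lemma gap_unlift (K : R -> Prop) (p q : R) (m : Z) : (forall x, K x -> 0 <= x < 1) ->
  gap (lift K) p q -> K (p + IZR m) -> K (q + IZR m) -> gap K (p + IZR m) (q + IZR m).
Proof.
  intros HK G A B. pose proof (gap_lift_IZR K p q m G) as (_ & _ & N & H).
  split; [exact A|]. split; [exact B|]. split; [exact N|].
  intros x Hx. apply H. unfold lift. rewrite frac_part_id; auto.
Qed.

(** The arc [(h, 1)] is free of [K], so lifted points closer than [1 - h] are not separated by an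
    integer plus that arc and have the same integer part. *)
Lemma unlift (K : R -> Prop) (h x y : R) : (forall x, K x -> 0 <= x <= h) ->
  lift K x -> lift K y -> Rabs (y - x) < 1 - h ->
  K (y + IZR (- Int_part x)).
Proof.
  intros HK Kx Ky H. assert (Kx' := HK _ Kx). assert (Ky' := HK _ Ky).
  unfold lift in Ky. unfold frac_part in Kx', Ky', Ky. apply Rabs_def2 in H.
  assert (E : Int_part y = Int_part x).
  { assert (E1 : IZR (Int_part y - Int_part x) < IZR 1) by (rewrite minus_IZR; lra).
    assert (E2 : IZR (Int_part x - Int_part y) < IZR 1) by (rewrite minus_IZR; lra).
    apply lt_IZR in E1, E2. lia. }
  rewrite E in Ky. rewrite opp_IZR. exact Ky.
Qed.

Lemma shape_translate (q : pts) (c : R) :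
  let q' := pmap (fun x => x + c) q in
  mono4 q -> mono4 q' /\ rB q' = rB q /\ rG q' = rG q.
Proof.
  destruct q as [x1 x2 x3 x4]. unfold mono4, rB, rG; simpl. intros H.
  replace (x2 + c - (x1 + c)) with (x2 - x1) by ring.
  replace (x3 + c - (x2 + c)) with (x3 - x2) by ring.
  replace (x4 + c - (x3 + c)) with (x4 - x3) by ring.
  split; [lra|]. split; reflexivity.
Qed.

(** The map [f] moves pairs on the line, whereas the blow-up is available for pairs of [C] only;
    short pairs can be translated back without changing their shape. *)
Lemma pair_unlift (K : R -> Prop) (h : R) (q : pts) : h < 1 -> (forall x, K x -> 0 <= x <= h) ->
  gap_pair (lift K) q -> hull q < 1 - h ->
  exists q', gap_pair K q' /\ rB q' = rB q /\ rG q' = rG q.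
Proof.
  intros Hh HK (G1 & G2 & M) Hq.
  assert (HK' : forall x, K x -> 0 <= x < 1) by (intros x Hx; specialize (HK x Hx); lra).
  set (m := (- Int_part (p1 q))%Z).
  destruct (shape_translate q (IZR m) M) as (M' & E1 & E2).
  exists (pmap (fun x => x + IZR m) q). split; [|split; assumption].
  assert (HH : forall y, lift K y -> y = p1 q \/ y = p2 q \/ y = p3 q \/ y = p4 q -> K (y + IZR m)).
  { intros y Ky Hy. apply (unlift K h); [exact HK|apply G1|exact Ky|].
    eapply Rle_lt_trans; [|exact Hq]. rewrite hull_minmax.
    pose proof (mono4_near q y M Hy). pose proof (mono4_near q (p1 q) M ltac:(auto)).
    apply Rabs_le. lra. }
  split; [|split; [|exact M']].
  - apply gap_unlift; auto; apply HH; auto; apply G1.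
  - apply gap_unlift; auto; apply HH; auto; apply G2.
Qed.

(** The blow-up at most doubles shape coordinates, so they stay below [4 * C0]. A hull of at least
    [g] then forces the first gap to have length at least [g / (1 + 8 * C0)]; the second is at least
    [/ (4 * C0)] times the first. This is the origin of [c]. *)
Lemma shapes_clustered (k : nat) (a b : nat -> R) (S : R -> R) (C : R -> Prop)
    (g mu La si be C0 ka Q d c : R) (lu lv : list R) :
  branches k a b S C g mu La si be ->
  0 < g < 1 -> 1 < mu -> 0 < be ->
  1 <= C0 -> 0 < ka <= 1 -> 0 < Q -> exp Q <= 1 + ka -> ka * (4 * C0) <= d ->
  si <= Q * (Rpower mu be - 1) ->
  c = g / ((1 + 8 * C0) * (4 * C0)) ->
  (forall q, gap_pair C q -> c <= Rabs (p2 q - p1 q) -> c <= Rabs (p4 q - p3 q) ->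
     In (rB q) lu /\ In (rG q) lv) ->
  forall q, gap_pair C q -> rB q <= 2 * C0 -> / (2 * C0) <= rG q <= 2 * C0 ->
    (exists x, In x lu /\ Rabs (rB q - x) <= d) /\ (exists x, In x lv /\ Rabs (rG q - x) <= d).
Proof.
  intros Hbr Hg Hmu Hbe HC0 Hka HQ HeQ Hkd Hpot Hc Hl q Hq HB HG.
  destruct (pair_blowup k a b S C g mu La si be Hbr Hg Hmu Hbe Q q Hpot HQ Hq)
    as [q' [Hq' [Hh [CB CG]]]].
  destruct (shape_nonneg q ltac:(apply Hq)) as [B0 G0].
  destruct (shape_nonneg q' ltac:(apply Hq')) as [B0' G0'].
  destruct (cmp_close (exp Q) ka (2 * C0) _ _ HeQ ltac:(lra) (conj B0 HB) B0' CB)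
    as (B1 & B2 & _).
  destruct (cmp_close (exp Q) ka (2 * C0) _ _ HeQ ltac:(lra) (conj G0 (proj2 HG)) G0' CG)
    as (D1 & D2 & D3).
  assert (HJ : g / (1 + 8 * C0) <= Rabs (p2 q' - p1 q')).
  { rewrite (hull_sum q' ltac:(apply Hq')) in Hh.
    pose proof (Rabs_pos (p2 q' - p1 q')).
    apply Rmult_le_reg_r with (1 + 8 * C0); [lra|].
    replace (g / (1 + 8 * C0) * (1 + 8 * C0)) with g by (field; lra). nra. }
  assert (Hg8 : 0 < g / (1 + 8 * C0)) by (apply Rdiv_lt_0_compat; lra).
  assert (Ec : c * (4 * C0) = g / (1 + 8 * C0)) by (subst c; field; lra).
  assert (Hc0 : 0 < c) by nra.
  destruct (Hl q' Hq') as [L1 L2].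
  - nra.
  - assert (EG : Rabs (p4 q' - p3 q') = rG q' * Rabs (p2 q' - p1 q')) by (unfold rG; field; lra).
    rewrite EG.
    assert (HrG : / (4 * C0) <= rG q').
    { assert (/ (2 * C0) = 2 * / (4 * C0)) by (field; lra). lra. }
    assert (Hi : 0 < / (4 * C0)) by (apply Rinv_0_lt_compat; lra).
    replace c with (/ (4 * C0) * (g / (1 + 8 * C0))) by (rewrite <- Ec; field; lra).
    apply Rmult_le_compat; lra.
  - split; [exists (rB q')|exists (rG q')]; (split; [assumption|lra]).
Qed.

Lemma branches_not_C1_minimal (g La mu be : R) :
  0 < g < 1 -> 0 < La -> 1 < mu -> 0 < be ->
  exists si, 0 < si /\ forall k a b S C, (2 <= k)%nat ->
    branches k a b S C g mu La si be -> ~ C1_minimal C.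
Proof.
  intros Hg HLa Hmu Hbe.
  (* Bounds the shape coordinates supplied by [gap_neighbour] and the inverse of the second, given
     that [exp Q <= 2]. *)
  set (C0 := 2 / g + 2 * La / g).
  assert (Hg1 : 1 < / g) by (rewrite <- Rinv_1; apply Rinv_lt_contravar; lra).
  assert (HC0g : C0 = 2 * / g + 2 * La * / g) by (unfold C0; field; lra).
  assert (HC0 : 1 <= C0) by nra.
  set (c := g / ((1 + 8 * C0) * (4 * C0))).
  assert (Hc : 0 < c) by (apply Rdiv_lt_0_compat; nra).
  destruct (shape_list c Hc) as [N HN].
  (* Chosen so that a barrier search past [N] centres with margin [3 * d] uses up exactly
     [/ (2 * C0)]. *)
  set (d := / (2 * C0) / ((2 * INR N + 1) * 3)).
  pose proof (pos_INR N) as HNp.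
  assert (Hd : 0 < d).
  { apply Rdiv_lt_0_compat; [apply Rinv_0_lt_compat; lra|lra]. }
  assert (HdN : (2 * INR N + 1) * (3 * d) <= / (2 * C0)).
  { right. unfold d. field. lra. }
  set (ka := Rmin 1 (d / (4 * C0))).
  assert (Hka : 0 < ka <= 1).
  { split; [apply Rmin_pos; [lra|apply Rdiv_lt_0_compat; lra]|apply Rmin_l]. }
  assert (Hkd : ka * (4 * C0) <= d).
  { replace d with (d / (4 * C0) * (4 * C0)) by (field; lra).
    apply Rmult_le_compat_r; [lra|apply Rmin_r]. }
  set (Q := ln (1 + ka)).
  assert (HQ : 0 < Q) by (unfold Q; rewrite <- ln_1; apply ln_increasing; lra).
  assert (HeQ : exp Q <= 1 + ka) by (right; apply exp_ln; lra).
  assert (Hpow : 1 < Rpower mu be).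
  { unfold Rpower. rewrite <- exp_0. apply exp_increasing.
    apply Rmult_lt_0_compat; [exact Hbe|]. rewrite <- ln_1. apply ln_increasing; lra. }
  (* The largest step cost for which the growth of the potential under expansion by [mu] pays. *)
  exists (Q * (Rpower mu be - 1)).
  assert (Hsi : 0 < Q * (Rpower mu be - 1)) by (apply Rmult_lt_0_compat; lra).
  split; [exact Hsi|]. set (si := Q * (Rpower mu be - 1)) in *.
  assert (Hpot : si <= Q * (Rpower mu be - 1)) by (right; reflexivity).
  intros k a b S C Hk Hbr (F & dF & HF & HK).
  assert (Hbr' := br_unit _ _ _ _ _ _ _ _ _ _ Hbr). destruct Hbr' as [h [Hh HC]].
  assert (HC1 : forall x, C x -> 0 <= x < 1) by (intros x Hx; specialize (HC x Hx); lra).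
  assert (Hclosed : forall x, (forall e, 0 < e -> exists y, C y /\ Rabs (x - y) < e) -> C x).
  { intros x Hx.
    assert (H01 : 0 <= x <= h).
    { split; apply Rnot_lt_le; intro Hlt.
      - destruct (Hx (- x) ltac:(lra)) as [y [Cy Hy]]. specialize (HC y Cy).
        apply Rabs_def2 in Hy. lra.
      - destruct (Hx (x - h) ltac:(lra)) as [y [Cy Hy]]. specialize (HC y Cy).
        apply Rabs_def2 in Hy. lra. }
    destruct HK as (_ & _ & Hcl & _). apply Hcl; [lra|].
    intros e He. destruct (Hx e He) as [y [Cy Hy]]. exists y. split; [exact Cy|].
    exists 0%Z. rewrite Rminus_0_r. exact Hy. }
  assert (Hperf := C_perfect k a b S C g mu La si be Hbr Hk Hg Hmu).
  assert (Hne : exists x, C x) by apply HK. destruct Hne as [x0 Cx0].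
  destruct (big_gap k a b S C g mu La si be Hbr Hk Hg Hclosed x0 Cx0) as [u [v [Huv _]]].
  apply (gap_lift C u v HC1) in Huv.
  destruct (lift_distortion F dF HF (1 + ka) ltac:(lra)) as [r0 [Hr0 Hdist]].
  (* In the window a hull is at most [1 + 4 * C0] times its first gap. A first gap below [r1] thus
     keeps the hull short enough both for the distortion of [F] and for translation back to [C]. *)
  set (r1 := Rmin r0 (1 - h) / (1 + 4 * C0)).
  assert (Hr1 : 0 < r1).
  { apply Rdiv_lt_0_compat; [apply Rmin_pos; lra|lra]. }
  assert (Hr1' : r1 * (1 + 4 * C0) = Rmin r0 (1 - h)) by (unfold r1; field; lra).
  pose proof (Rmin_l r0 (1 - h)) as Hrl. pose proof (Rmin_r r0 (1 - h)) as Hrr.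
  (* The orbit starts at a late iterate of the gap, so that all further iterates are below [r1]; no
     estimate along the orbit is needed for this. *)
  destruct (gap_shrink F dF HF C HK Hperf u v r1 Huv Hr1) as [n0 Hn0].
  pose proof (gap_iter F dF HF C HK n0 u v Huv) as Huv'.
  set (m := (- Int_part (Nat.iter n0 F u))%Z).
  set (p := Nat.iter n0 F u + IZR m). set (q := Nat.iter n0 F v + IZR m).
  assert (Hpq : gap C p q).
  { apply gap_unlift; [exact HC1|exact Huv'| |].
    - apply (unlift C h); [exact HC|apply Huv'|apply Huv'|].
      rewrite Rminus_diag, Rabs_R0. lra.
    - apply (unlift C h); [exact HC|apply Huv'|apply Huv'|].
      specialize (Hn0 n0 (le_n _)). nra. }
  assert (HJ : forall n, Rabs (Nat.iter n F q - Nat.iter n F p) < r1).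
  { intros n. specialize (Hn0 (n + n0)%nat ltac:(lia)). rewrite !Nat.iter_add in Hn0.
    unfold p, q. destruct (iter_shift F dF HF n m) as [m' Hm']. rewrite !Hm'.
    replace (_ - _) with (Nat.iter n F (Nat.iter n0 F v) - Nat.iter n F (Nat.iter n0 F u)) by ring.
    exact Hn0. }
  destruct (gap_neighbour k a b S C g mu La si be Hbr Hk Hg Hmu HLa Hbe Hclosed Q p q Hpot HQ Hpq)
    as [x [y (Hpair & HB & HG & HG')]].
  set (q0 := Pts p q x y) in *.
  set (qn := fun n => pmap (Nat.iter n F) q0).
  assert (HL : forall n, gap_pair (lift C) (qn n)).
  { intros n. destruct Hpair as (G1 & G2 & M).
    split; [apply (gap_iter F dF HF C HK), gap_lift; assumption|].
    split; [apply (gap_iter F dF HF C HK), gap_lift; assumption|].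
    unfold mono4, qn; simpl. unfold mono4 in M; simpl in M.
    destruct (iter_mono F dF HF n) as [Hm|Hm]; destruct M as [(A & B & D)|(A & B & D)];
      apply Hm in A; apply Hm in B; apply Hm in D; lra. }
  assert (HH : forall n, hull (qn n) = Rabs (Nat.iter n F q - Nat.iter n F p) *
    (1 + rB (qn n) + rG (qn n))) by (intros n; apply (hull_sum (qn n)), HL).
  destruct (HN C rB) as [lu [Hlu Hlu']]; [intros z Hz; specialize (HC1 z Hz); lra|].
  destruct (HN C rG) as [lv [Hlv Hlv']]; [intros z Hz; specialize (HC1 z Hz); lra|].
  assert (Htrap : forall n, rB (qn n) <= 2 * C0 /\ / (2 * C0) <= rG (qn n) <= 2 * C0).
  { apply (walk_trapped N C0 d (fun n => rB (qn n)) (fun n => rG (qn n)) lu lv); auto.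
    - change (qn 0%nat) with q0. unfold Rdiv in HB. nra.
    - change (qn 0%nat) with q0. split; [|unfold Rdiv in HG; nra].
      assert (Hq0 : 0 <= rG q0) by (apply shape_nonneg, Hpair).
      assert (H2 : g / La <= 2 * rG q0) by nra.
      apply Rmult_le_reg_l with C0; [lra|]. rewrite Rinv_r by lra.
      assert (1 <= 2 * La * / g * rG q0).
      { apply Rmult_le_reg_l with (g / La); [apply Rdiv_lt_0_compat; lra|].
        replace (g / La * (2 * La * / g * rG q0)) with (2 * rG q0) by (field; lra). lra. }
      assert (0 <= / g * rG q0) by (apply Rmult_le_pos; lra). nra.
    - intros n HBn HGn. cbv beta in *.
      destruct (shape_nonneg (qn n) ltac:(apply HL)) as [B0 G0].
      specialize (HH n). specialize (HJ n).
      assert (Hhull : hull (qn n) < Rmin r0 (1 - h)).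
      { rewrite HH, <- Hr1'.
        pose proof (Rabs_pos (Nat.iter n F q - Nat.iter n F p)). nra. }
      destruct (pair_unlift C h (qn n) Hh HC (HL n) ltac:(lra)) as [q' [Hq' [E1 E2]]].
      destruct (shapes_clustered k a b S C g mu La si be C0 ka Q d c lu lv Hbr Hg Hmu Hbe
        HC0 Hka HQ HeQ Hkd Hpot eq_refl) with (q := q') as [K1 K2]; auto.
      { rewrite E1. exact HBn. }
      { rewrite E2. exact HGn. }
      rewrite E1 in K1. rewrite E2 in K2.
      assert (Hcmp : cmp_shape (1 + ka) (qn n) (qn (Datatypes.S n))).
      { apply (cmp_shape_pmap (1 + ka) F (qn n)); [apply HL|apply (HL (Datatypes.S n))|].
        intros z1 z2 z3 z4 A1 A2 A3 A4.
        apply (Hdist (Rmin (p1 (qn n)) (p4 (qn n))) (Rmax (p1 (qn n)) (p4 (qn n)))); auto.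
        rewrite <- hull_minmax. lra. }
      destruct Hcmp as [CB CG].
      destruct (shape_nonneg (qn (Datatypes.S n)) ltac:(apply HL)) as [B0' G0'].
      destruct (cmp_close (1 + ka) ka (2 * C0) _ _ ltac:(lra) ltac:(lra) (conj B0 HBn) B0' CB)
        as (_ & D1 & _).
      destruct (cmp_close (1 + ka) ka (2 * C0) _ _ ltac:(lra) ltac:(lra) (conj G0 (proj2 HGn)) G0' CG)
        as (_ & D2 & _).
      rewrite Rabs_minus_sym in D1. rewrite Rabs_minus_sym in D2.
      split; [exact K1|]. split; [exact K2|]. split; lra. }
  assert (M0 : mono4 q0) by apply Hpair.
  (* The interval is spanned by the pair, and [q], the inner end of the first gap, is its interior
     point in [C]. *)
  apply (contracting_interval_absurd F dF HF C HK Hperf (Rmin p y) q (Rmax p y)).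
  - apply Hpq.
  - unfold mono4 in M0; simpl in M0. unfold Rmin, Rmax. destruct (Rle_dec p y); lra.
  - intros r Hr.
    assert (Hr' : 0 < r / (1 + 4 * C0)) by (apply Rdiv_lt_0_compat; lra).
    destruct (gap_shrink F dF HF C HK Hperf p q _ (gap_lift C p q HC1 Hpq) Hr') as [n1 Hn1].
    exists n1. intros n Hn. specialize (Hn1 n Hn). specialize (HH n).
    destruct (Htrap n) as [T1 T2]. destruct (shape_nonneg (qn n) ltac:(apply HL)) as [B0 G0].
    assert (Hhull : hull (qn n) < r).
    { rewrite HH. replace r with (r / (1 + 4 * C0) * (1 + 4 * C0)) by (field; lra).
      pose proof (Rabs_pos (Nat.iter n F q - Nat.iter n F p)). nra. }
    unfold hull, qn in Hhull; simpl in Hhull.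
    unfold Rmin, Rmax. destruct (Rle_dec p y); [|rewrite Rabs_minus_sym]; exact Hhull.
Qed.

(** * Constants determined by the intervals, and the choice of [eps] *)

Lemma separation (k : nat) (a b : nat -> R) :
  (forall i j, (i < k)%nat -> (j < k)%nat -> i <> j -> b i < a j \/ b j < a i) ->
  exists g, 0 < g < 1 /\ forall i j x y, (i < k)%nat -> (j < k)%nat -> i <> j ->
    a i <= x <= b i -> a j <= y <= b j -> g <= Rabs (x - y).
Proof.
  intros H.
  assert (Hfin : forall (P : nat -> R -> Prop),
    (forall i g g', P i g -> 0 < g' <= g -> P i g') ->
    forall n, (forall i, (i < n)%nat -> exists g, 0 < g /\ P i g) ->
    exists g, 0 < g < 1 /\ forall i, (i < n)%nat -> P i g).
  { intros P HP. induction n as [|n IH]; intros Hn.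
    - exists (1 / 2). split; [lra|]. intros; lia.
    - destruct IH as [g [Hg HI]]; [intros; apply Hn; lia|].
      destruct (Hn n ltac:(lia)) as [g' [Hg' Pn]].
      exists (Rmin g g'). pose proof (Rmin_l g g'). pose proof (Rmin_r g g').
      assert (0 < Rmin g g') by (apply Rmin_pos; lra). split; [lra|].
      intros i Hi. destruct (Nat.eq_dec i n) as [->|].
      + apply (HP n g'); [exact Pn|lra].
      + apply (HP i g); [apply HI; lia|lra]. }
  destruct (Hfin (fun i g => forall j x y, (j < k)%nat -> i <> j ->
    a i <= x <= b i -> a j <= y <= b j -> g <= Rabs (x - y))) with (n := k) as [g [Hg HI]].
  - intros i g g' Hi Hg j x y Hj Hij Hx Hy. specialize (Hi j x y Hj Hij Hx Hy). lra.
  - intros i Hi.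
    destruct (Hfin (fun j g => forall x y, i <> j ->
      a i <= x <= b i -> a j <= y <= b j -> g <= Rabs (x - y))) with (n := k) as [g [Hg HI]].
    + intros j g g' Hj Hg x y Hij Hx Hy. specialize (Hj x y Hij Hx Hy). lra.
    + intros j Hj. destruct (Nat.eq_dec i j) as [->|Hij]; [exists 1; split; [lra|tauto]|].
      destruct (H i j Hi Hj Hij).
      * exists (a j - b i). split; [lra|]. intros x y _ Hx Hy. rewrite Rabs_left; lra.
      * exists (a i - b j). split; [lra|]. intros x y _ Hx Hy. rewrite Rabs_right; lra.
    + exists g. split; [lra|]. intros j x y Hj. apply HI, Hj.
  - exists g. split; [exact Hg|]. intros i j x y Hi. apply HI, Hi.
Qed.

Lemma min_length (k : nat) (a b : nat -> R) : (forall j, (j < k)%nat -> a j < b j) ->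
  exists la, 0 < la /\ forall j, (j < k)%nat -> la <= b j - a j.
Proof.
  induction k as [|k IH]; intros H.
  - exists 1. split; [lra|]. intros; lia.
  - destruct IH as [la [Hla HI]]; [intros; apply H; lia|].
    specialize (H k ltac:(lia)).
    exists (Rmin la (b k - a k)). split; [apply Rmin_pos; lra|].
    intros j Hj. destruct (Nat.eq_dec j k) as [->|]; [apply Rmin_r|].
    eapply Rle_trans; [apply Rmin_l|]. apply HI. lia.
Qed.

Theorem theorem1 :
  forall (k : nat) (a b : nat -> R) (l1 l2 : R),
    (2 <= k)%nat ->
    (forall j, (j < k)%nat -> 0 <= a j < b j /\ b j < 1) ->
    (forall i j, (i < k)%nat -> (j < k)%nat -> i <> j -> b i < a j \/ b j < a i) ->
    0 <= l1 <= l2 -> l2 < 1 ->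
    (forall j, (j < k)%nat -> l1 <= a j /\ b j <= l2) ->
    forall M alpha, 0 < M -> 0 < alpha ->
      exists eps, 0 < eps /\
        forall S dS : R -> R, in_A k a b l1 l2 M eps alpha S dS ->
          ~ C1_minimal (CS k a b S).
Proof.
  intros k a b l1 l2 Hk Hab Hdis Hl Hl2 HL M alpha HM Hal.
  destruct (separation k a b Hdis) as [g [Hg Hsep]].
  destruct (min_length k a b) as [la [Hla Hlen]].
  { intros j Hj. destruct (Hab j Hj). lra. }
  destruct (branches_not_C1_minimal g (3 / la) (1 + g / 2) (alpha / 2) Hg) as [si [Hsi Hmain]];
    try lra.
  { apply Rdiv_lt_0_compat; lra. }
  set (t := ln ((1 + g) / (1 + g / 2))).
  assert (Hq : 1 < (1 + g) / (1 + g / 2)).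
  { apply Rmult_lt_reg_r with (1 + g / 2); [lra|].
    replace ((1 + g) / (1 + g / 2) * (1 + g / 2)) with (1 + g) by (field; lra). lra. }
  assert (Ht : 0 < t) by (unfold t; rewrite <- ln_1; apply ln_increasing; lra).
  (* The cap 1 gives [exp eps <= 3], [t] preserves the expansion [1 + g / 2], and [si * si / M]
     makes the geometric mean of the two distortion bounds at most [si] times the power with
     exponent [alpha / 2]. *)
  set (eps := Rmin 1 (Rmin t (si * si / M))).
  pose proof (Rmin_l 1 (Rmin t (si * si / M))) as E1.
  pose proof (Rmin_r 1 (Rmin t (si * si / M))) as E2.
  pose proof (Rmin_l t (si * si / M)) as E3. pose proof (Rmin_r t (si * si / M)) as E4.
  fold eps in E1, E2.
  exists eps. split.
  { repeat apply Rmin_pos; try lra. apply Rdiv_lt_0_compat; nra. }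
  intros S dS HS. apply (Hmain k a b S); [exact Hk|].
  apply (branches_of_A k a b l1 l2 M eps alpha g la si S dS); auto.
  - apply Rle_trans with (si * si / M * M); [apply Rmult_le_compat_r; lra|].
    right. field. lra.
  - assert (exp eps <= (1 + g) / (1 + g / 2)).
    { rewrite <- (exp_ln ((1 + g) / (1 + g / 2))) by lra. apply exp_le. fold t. lra. }
    apply Rle_trans with ((1 + g) / (1 + g / 2) * (1 + g / 2)); [apply Rmult_le_compat_r; lra|].
    right. field. lra.
Qed.
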